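(* Let $k=k_n$ and $m=m_n$ be integer sequences with $n>2k_n$, $0\le m_n\le\lfloor(n-2k_n)/2\rfloor$, $\lim_{n\to\infty}k_n=\infty$, and such that for every $\epsilon>0$ $$\sum_n 2(k_n+1)\exp\Bigg(-(n-2k_n)\Big[\frac{\epsilon^2}{2(k_n+1)L_{\max}^2}-2|\mathcal Z|^{2k_n}\Big\{h\Big(\frac{m_n}{n-2k_n}\Big)+\frac{(m_n+1)\ln N}{n-2k_n}\Big\}\Big]\Bigg)<\infty,$$ with $h(x)=-x\ln x-(1-x)\ln(1-x)$ and $N=|\mathcal S|$. Let $\hat{\mathbf X}^n$ be the $(k_n,m_n)$-S-DUDE. Then for every process distribution $P_{\mathbf X}\in\mathcal P\{m_n\}$, $$\lim_{n\to\infty}\Big[E\,L_{\hat{\mathbf X}^n}(X^n,Z^n)-\mathbb D(P_{X^n},\Pi)\Big]=0,$$ where $X^n$ is drawn from $P_{X^n}$ and $Z^n$ is the output of the channel $\Pi$ with input $X^n$.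
   Context: Let $\mathcal X,\mathcal Z,\hat{\mathcal X}$ be finite alphabets and $\Pi=\{\Pi(x,z)\}$ a $|\mathcal X|\times|\mathcal Z|$ stochastic matrix (discrete memoryless channel) of full row rank; given input $X^n$, the outputs $Z_t$ are conditionally independent with $\Pr(Z_t=z\mid X^n)=\Pi(X_t,z)$. Fix a loss $\Lambda:\mathcal X\times\hat{\mathcal X}\to[0,\infty)$, $\Lambda_{\max}=\max\Lambda$. Let $\mathcal S$ be the set of maps $\mathcal Z\to\hat{\mathcal X}$; fix a real $|\mathcal Z|\times|\mathcal X|$ matrix $H$ with $\Pi H=I$ and let $h(z)$ be the column vector equal to its $z$-th row; $\rho_x(s)=\sum_z\Lambda(x,s(z))\Pi(x,z)$; $\ell(z,s)=h(z)^T\rho(s)$; $\ell_{\max}=\max_{z,s}\ell-\min_{z,s}\ell$; $L_{\max}=\Lambda_{\max}+\ell_{\max}$. An $n$-block denoiser is $\hat{\mathbf X}^n=(\hat X_t)_{t=1}^n$, $\hat X_t:\mathcal Z^n\to\hat{\mathcal X}$, with $L_{\hat{\mathbf X}^n}(x^n,z^n)=\frac1n\sum_t\Lambda(x_t,\hat X_t(z^n))$; $\mathbb D(P_{X^n},\Pi)=\min_{\hat{\mathbf X}^n}E\,L_{\hat{\mathbf X}^n}(X^n,Z^n)$, the minimum over all $n$-block denoisers. S-DUDE: for $z^n$ and $k+1\le t\le n-k$, $\mathbf c_t=(z_{t-k}^{t-1},z_{t+1}^{t+k})$, $\mathcal T(\mathbf c)=\{t:k+1\le t\le n-k,\mathbf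 c_t=\mathbf c\}$; $\mathcal S^n_{k,m}(z^n)$ is the set of $(\sigma_{k+1},\dots,\sigma_{n-k})\in\mathcal S^{n-2k}$ such that for every $\mathbf c\in\mathcal Z^{2k}$, writing $\mathcal T(\mathbf c)=\{\tau_1<\dots<\tau_r\}$, at most $m$ indices $j<r$ have $\sigma_{\tau_j}\ne\sigma_{\tau_{j+1}}$. The $(k,m)$-S-DUDE outputs $\hat X_t(z^n)=\hat\sigma_t(z_t)$ for $k+1\le t\le n-k$, where $(\hat\sigma_t)$ minimizes $\frac1{n-2k}\sum_{t=k+1}^{n-k}\ell(z_t,\sigma_t)$ over $\mathcal S^n_{k,m}(z^n)$, and a fixed arbitrary symbol for other $t$. Class $\mathcal P\{m_n\}$: a distribution $P_{\mathbf X}$ on $\mathcal X^\infty$ belongs to it if there exist $M\ge1$, distributions $P^{(1)},\dots,P^{(M)}$ of stationary processes with values in $\mathcal X$, and a process $\mathbf A$ with values in $\{1,\dots,M\}$ such that $r(A^n)=\sum_{j=1}^{n-1}\mathbf 1_{\{A_j\ne A_{j+1}\}}\le m_n$ a.s. for all $n$, and for all $n$, $P_{X^n}(x^n)=\sum_{a^n}P_{A^n}(a^n)\prod_{i=1}^{r+1}P^{(a_{\tau_i})}(x_{\tau_{i-1}+1}^{\tau_i})$, where $r=r(a^n)$, $\tau_0=0$, $\tau_{r+1}=n$, and for $1\le i\le r$, $\tau_i$ is the smallest $t$ with $\sum_{j=1}^t\mathbf 1_{\{a_j\ne a_{j+1}\}}=i$ (the end of the $i$-th constant block), and $P^{(a)}(x_1^\ell)$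 denotes the probability the stationary process $P^{(a)}$ assigns to its first $\ell$ symbols being $x_1^\ell$. *)

(* Defs.v *)
From HB Require Import structures.
From mathcomp Require Import all_boot all_order all_algebra.
From mathcomp Require Import all_classical all_reals all_analysis.
Set Implicit Arguments. Unset Strict Implicit. Unset Printing Implicit Defensive.
Import Order.TTheory GRing.Theory Num.Theory.
Local Open Scope ring_scope.

Section Defs.
Variable R : realType.

(* A process distribution on T^oo is given by its finite-dimensional
   distributions p(x_1^n) (x_1^n : seq T), which must be nonnegative,
   normalized and Kolmogorov-consistent. *)
Definition is_process (T : finType) (p : seq T -> R) : Prop :=
  [/\ p [::] = 1, (forall s, 0 <= p s) & (forall s, p s = \sum_(a : T) p (rcons s a))].

Definition stationary (T : finType) (p : seq T -> R) : Prop :=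
  forall s, p s = \sum_(a : T) p (a :: s).

Definition nswitch (T : eqType) (a : seq T) : nat :=
  count (fun q => q.1 != q.2) (zip a (behead a)).

Fixpoint rle (T : eqType) (a : seq T) : seq (T * nat) :=
  match a with
  | [::] => [::]
  | b :: a' =>
    match rle a' with
    | (c, l) :: r => if c == b then (c, l.+1) :: r else (b, 1%N) :: (c, l) :: r
    | [::] => [:: (b, 1%N)]
    end
  end.

Fixpoint blockprod (I X : Type) (P : I -> seq X -> R) (rl : seq (I * nat)) (x : seq X) : R :=
  match rl with
  | [::] => 1
  | (c, l) :: r => P c (take l x) * blockprod P r (drop l x)
  end.

Definition in_class_P (X : finType) (mseq : nat -> nat) (pX : seq X -> R) : Prop :=
  exists (M : nat) (P : 'I_M -> seq X -> R) (pA : seq 'I_M -> R),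
    [/\ (1 <= M)%N,
        (forall a, is_process (P a) /\ stationary (P a)),
        is_process pA,
        (forall n (a : n.-tuple 'I_M), 0 < pA a -> (nswitch a <= mseq n)%N) &
        (forall n (x : n.-tuple X),
            pX x = \sum_(a : n.-tuple 'I_M) pA a * blockprod P (rle a) x)].

Variables (X Z Xh : finType).

Definition stochastic (Pi : X -> Z -> R) : Prop :=
  (forall x z, 0 <= Pi x z) /\ (forall x, \sum_(z : Z) Pi x z = 1).

Definition chan_matrix (Pi : X -> Z -> R) : 'M[R]_(#|X|, #|Z|) :=
  \matrix_(i, j) Pi (enum_val i) (enum_val j).

Definition full_row_rank (Pi : X -> Z -> R) : Prop :=
  \rank (chan_matrix Pi) = #|X|.

Definition chan_right_inv (Pi : X -> Z -> R) (H : Z -> X -> R) : Prop :=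
  forall x x', \sum_(z : Z) Pi x z * H z x' = (x == x')%:R.

Definition Smap := {ffun Z -> Xh}.

Definition rho (Pi : X -> Z -> R) (Lam : X -> Xh -> R) (s : Smap) (x : X) : R :=
  \sum_(z : Z) Lam x (s z) * Pi x z.

Definition ell (Pi : X -> Z -> R) (H : Z -> X -> R) (Lam : X -> Xh -> R) (z : Z) (s : Smap) : R :=
  \sum_(x : X) H z x * rho Pi Lam s x.

Definition Lammax (Lam : X -> Xh -> R) : R :=
  \big[Num.max/0]_(p : X * Xh) Lam p.1 p.2.

(* max ell - min ell, written as the max of pairwise differences *)
Definition ellmax Pi H Lam : R :=
  \big[Num.max/0]_(p : (Z * Smap) * (Z * Smap))
     (ell Pi H Lam p.1.1 p.1.2 - ell Pi H Lam p.2.1 p.2.2).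

Definition Lmax Pi H Lam : R := Lammax Lam + ellmax Pi H Lam.

(* an n-block denoiser: t |-> (z^n |-> hat X_t(z^n)); indices t are 0-based *)
Definition denoiser (n : nat) := 'I_n -> n.-tuple Z -> Xh.

Definition blockloss n (Lam : X -> Xh -> R) (d : denoiser n) (x : n.-tuple X) (z : n.-tuple Z) : R :=
  n%:R^-1 * \sum_(t < n) Lam (tnth x t) (d t z).

Definition exp_loss n (pX : seq X -> R) (Pi : X -> Z -> R) Lam (d : denoiser n) : R :=
  \sum_(x : n.-tuple X) \sum_(z : n.-tuple Z)
     pX x * (\prod_(t < n) Pi (tnth x t) (tnth z t)) * blockloss Lam d x z.

Definition Dbayes n (pX : seq X -> R) Pi Lam (xh0 : Xh) : R :=
  \big[Num.min/@exp_loss n pX Pi Lam (fun _ _ => xh0 : Xh)]_(d : {ffun 'I_n -> {ffun n.-tuple Z -> Xh}})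
     @exp_loss n pX Pi Lam (fun t z => d t z).

(* two-sided context of (0-based) position t: (z_{t-k}^{t-1}, z_{t+1}^{t+k}) *)
Definition ctx n (k : nat) (z : n.-tuple Z) (t : nat) : seq Z * seq Z :=
  (take k (drop (t - k) z), take k (drop t.+1 z)).

Definition in_range n k (t : 'I_n) : bool := (k <= t)%N && (t < n - k)%N.

(* (sigma_t) in S^n_{k,m}(z^n): only the values at t in range matter *)
Definition in_Snkm n k m (z : n.-tuple Z) (sigma : 'I_n -> Smap) : Prop :=
  forall c : seq Z * seq Z,
    (nswitch [seq sigma t | t <- enum 'I_n & in_range k t && (ctx k z t == c)] <= m)%N.

Definition sdude_cost n k Pi H Lam (z : n.-tuple Z) (sigma : 'I_n -> Smap) : R :=
  (n - 2 * k)%:R^-1 * \sum_(t < n | in_range k t) ell Pi H Lam (tnth z t) (sigma t).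

Definition is_sdude_sel n k m Pi H Lam (sel : n.-tuple Z -> 'I_n -> Smap) : Prop :=
  forall z, in_Snkm k m z (sel z) /\
    (forall sigma, in_Snkm k m z sigma -> sdude_cost k Pi H Lam z (sel z) <= sdude_cost k Pi H Lam z sigma).

Definition sdude n k (sel : n.-tuple Z -> 'I_n -> Smap) (xh0 : Xh) : denoiser n :=
  fun t z => if in_range k t then sel z t (tnth z t) else xh0.

End Defs.

Definition bin_entropy (R : realType) (x : R) : R := - x * ln x - (1 - x) * ln (1 - x).

(* Main.v *)
Require Import Defs.
From HB Require Import structures.
From mathcomp Require Import all_boot all_order all_algebra.
From mathcomp Require Import all_classical all_reals all_analysis.
From mathcomp Require Import zify ring lra.
Import Order.TTheory GRing.Theory Num.Theory.
Import numFieldNormedType.Exports.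
Local Open Scope classical_set_scope.
Local Open Scope ring_scope.

Set Implicit Arguments.
Unset Strict Implicit.
Unset Printing Implicit Defensive.

(* All expectations are finite sums, and the regret per position is bounded by
   comparing the S-DUDE with a genie that knows the switching sequence [a].

   Lower bound: given [a], the pairs (X, Z) form independent blocks of stationary
   processes, so any denoiser loses at position [t] at least the infimum over all
   two-sided windows of the Bayes loss of the process [a_t].

   Upper bound: the genie applies at [t] a fixed near-optimal window rule of the
   process [a_t].  For each context its rule changes only when [a] does, so it
   lies in S^n_{k,m}, and it is near-optimal except within a bounded distance of
   the at most [m_n + 1] block ends.  The S-DUDE has a smaller estimated loss; the
   estimate is unbiased for the genie, whose rule at [t] ignores [z_t].  For the
   S-DUDE itself the expected estimation error is controlled by splitting the
   positions mod [k + 1], conditioning on the other classes, and bounding the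
   exponential moment of the maximum by a sum over all assignments of rules,
   weighted by [theta ^ (number of switches)].  Termwise convergence to 0 of the
   series in the hypothesis makes this error and the fraction of exceptional
   positions vanish. *)

(** * Sums over words and marginals of stationary processes *)

Section SumsOverWords.
Variables (R : realType) (T : finType).

(** The summand lives on [seq T], so that words can be cut and concatenated without casts between
    tuple lengths. *)
Definition wsum (n : nat) (F : seq T -> R) : R := \sum_(w : n.-tuple T) F w.

Lemma eq_wsum n (F G : seq T -> R) :
  (forall w, size w = n -> F w = G w) -> wsum n F = wsum n G.
Proof. by move=> FG; apply: eq_bigr => w _; rewrite FG ?size_tuple. Qed.

Lemma le_wsum n (F G : seq T -> R) :
  (forall w, size w = n -> F w <= G w) -> wsum n F <= wsum n G.
Proof. by move=> FG; apply: ler_sum => w _; rewrite FG ?size_tuple. Qed.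

Lemma wsum_ge0 n (F : seq T -> R) : (forall w, 0 <= F w) -> 0 <= wsum n F.
Proof. by move=> F0; apply: sumr_ge0. Qed.

Lemma wsumMl n c (F : seq T -> R) : wsum n (fun w => c * F w) = c * wsum n F.
Proof. by rewrite /wsum mulr_sumr. Qed.

Lemma wsumMr n c (F : seq T -> R) : wsum n (fun w => F w * c) = wsum n F * c.
Proof. by rewrite /wsum mulr_suml. Qed.

Lemma wsum_exchange (I : finType) n (F : I -> seq T -> R) :
  wsum n (fun w => \sum_i F i w) = \sum_i wsum n (F i).
Proof. exact: exchange_big. Qed.

Lemma wsum0 (F : seq T -> R) : wsum 0 F = F [::].
Proof.
rewrite /wsum (big_pred1 [tuple]) // => w.
by apply/esym/eqP/val_inj; case: w => -[].
Qed.

Lemma wsumS n (F : seq T -> R) :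
  wsum n.+1 F = \sum_a wsum n (fun w => F (a :: w)).
Proof.
rewrite /wsum pair_big /=.
rewrite (reindex (fun p : T * n.-tuple T => [tuple of p.1 :: p.2])) //=.
exists (fun w : n.+1.-tuple T => (thead w, [tuple of behead w])).
- move=> [a w] _ /=; congr pair; exact: val_inj.
- by move=> w _ /=; rewrite -tuple_eta.
Qed.

Lemma wsum_cat p q (F : seq T -> R) :
  wsum (p + q) F = wsum p (fun u => wsum q (fun v => F (u ++ v))).
Proof.
elim: p F => [|p IH] F; first by rewrite wsum0.
by rewrite addSn !wsumS; apply: eq_bigr => a _; rewrite IH.
Qed.

Lemma ler_wsum_term (F : seq T -> R) (w : seq T) :
  (forall u, 0 <= F u) -> F w <= wsum (size w) F.
Proof.
move=> F0; rewrite /wsum (bigD1 (in_tuple w)) //= lerDl.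
exact: sumr_ge0.
Qed.

End SumsOverWords.

Section ProcessMarginals.
Variables (R : realType) (T : finType) (Q : seq T -> R).
Hypotheses (procQ : is_process Q) (statQ : stationary Q).

Lemma wsum_process_suffix j u : wsum j (fun y => Q (u ++ y)) = Q u.
Proof.
have [_ _ cons] := procQ.
elim: j u => [|j IH] u; first by rewrite wsum0 cats0.
rewrite wsumS [RHS]cons; apply: eq_bigr => a _.
by rewrite -IH; apply: eq_wsum => w _; rewrite cat_rcons.
Qed.

Lemma wsum_stationary_prefix i u : wsum i (fun y => Q (y ++ u)) = Q u.
Proof.
elim: i => [|i IH]; first by rewrite wsum0.
rewrite wsumS -wsum_exchange -[RHS]IH.
by apply: eq_wsum => w _; rewrite [RHS]statQ.
Qed.

Lemma wsum_process_mass l : wsum l Q = 1.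
Proof. by have := wsum_process_suffix l [::]; case: procQ => ->. Qed.

(** The suffix is summed out by Kolmogorov consistency, the prefix by stationarity. *)
Lemma wsum_window i l j (G : seq T -> R) :
  wsum (i + (l + j)) (fun w => Q w * G (take l (drop i w))) =
  wsum l (fun w => Q w * G w).
Proof.
rewrite wsum_cat.
transitivity (wsum i (fun u => wsum l (fun v => Q (u ++ v) * G v))).
  apply: eq_wsum => u su; rewrite wsum_cat; apply: eq_wsum => v sv.
  rewrite -(wsum_process_suffix j (u ++ v)) -wsumMr; apply: eq_wsum => y _.
  by rewrite catA -catA -su drop_size_cat // -sv take_size_cat.
rewrite /wsum exchange_big /=; apply: eq_bigr => v _.
by rewrite -mulr_suml -[in RHS](wsum_stationary_prefix i).
Qed.

End ProcessMarginals.

(** * Run lengths and numbers of switches *)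

Section RunLengthEncoding.
Variable (T : eqType).

(** Left inverse of [rle]. Facts about blocks are proved by induction on arbitrary run lists, whose
    neighbouring runs may carry the same symbol, and then applied to [rle a]. *)
Definition unrle (rl : seq (T * nat)) : seq T :=
  flatten [seq nseq p.2 p.1 | p <- rl].

Lemma size_unrle rl : size (unrle rl) = sumn (unzip2 rl).
Proof. by elim: rl => //= -[c l] r IH; rewrite size_cat size_nseq IH. Qed.

Lemma rleK : cancel (@rle T) unrle.
Proof.
elim=> //= b a; case: (rle a) => [|[c l] r] /= <- //.
by case: eqP => [->|].
Qed.

Lemma nswitch_cons2 (b c : T) s :
  nswitch (b :: c :: s) = ((b != c) + nswitch (c :: s))%N.
Proof. by []. Qed.

Lemma rle_cons (b : T) a : exists l r, rle (b :: a) = (b, l) :: r.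
Proof.
rewrite /=; case: (rle a) => [|[c l] r]; first by exists 1%N, [::].
by case: eqP => [->|_]; [exists l.+1, r | exists 1%N, ((c, l) :: r)].
Qed.

Lemma size_rle_le (a : seq T) : (size (rle a) <= (nswitch a).+1)%N.
Proof.
elim: a => [|b [|c a] IH] //; rewrite nswitch_cons2.
have [l [r E]] := rle_cons c a; move: IH.
have -> : rle (b :: c :: a) =
  if c == b then (c, l.+1) :: r else (b, 1%N) :: (c, l) :: r.
  by rewrite -[RHS]/(if _ then _ else _) [LHS]/= -/(rle (c :: a)) E.
by rewrite E eq_sym; case: eqP => _ /=; rewrite ?add0n ?add1n.
Qed.

Lemma nswitch_cons_triangle (x y : T) s :
  (nswitch (x :: s) <= (x != y) + nswitch (y :: s))%N.
Proof.
case: s => [|z s]; first by rewrite /nswitch.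
rewrite !nswitch_cons2 addnA leq_add2r.
by case: (eqVneq x y) => [->|_] //=; rewrite (leq_trans (leq_b1 _)).
Qed.

Lemma nswitch_cons_le (x : T) s : (nswitch s <= nswitch (x :: s))%N.
Proof. by case: s => [|y s] //; rewrite nswitch_cons2 leq_addl. Qed.

Lemma nswitch_cons_subseq (x : T) s1 s2 :
  subseq s1 s2 -> (nswitch (x :: s1) <= nswitch (x :: s2))%N.
Proof.
elim: s2 s1 x => [|y2 s2 IH] [|y1 s1] x //=.
case: eqP => [->|_] sub; rewrite [leqRHS]nswitch_cons2.
  by rewrite nswitch_cons2 leq_add2l IH.
by apply: leq_trans (nswitch_cons_triangle _ y2 _) _; rewrite leq_add2l IH.
Qed.

(** Deleting an inner entry merges two comparisons of neighbours into one; by the triangle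
    inequality for [!=] no switch is gained. *)
Lemma nswitch_subseq (s1 s2 : seq T) :
  subseq s1 s2 -> (nswitch s1 <= nswitch s2)%N.
Proof.
elim: s2 s1 => [|y2 s2 IH] [|y1 s1] //=.
case: eqP => [->|_] sub; first exact: nswitch_cons_subseq.
exact: leq_trans (IH _ sub) (nswitch_cons_le _ _).
Qed.

End RunLengthEncoding.

Lemma nswitch_map (T U : eqType) (f : T -> U) (s : seq T) :
  (nswitch (map f s) <= nswitch s)%N.
Proof.
elim: s => [|x [|y s] IH] //; rewrite /= !nswitch_cons2 leq_add //.
by case: (eqVneq x y) => [->|_]; rewrite ?eqxx ?leq_b1.
Qed.

(** * Products of independent stationary blocks *)

Section BlockProducts.
Variables (R : realType) (I : eqType) (W : finType) (Q : I -> seq W -> R).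
Hypotheses (procQ : forall c, is_process (Q c))
           (statQ : forall c, stationary (Q c)).
Variable c0 : I.

Lemma blockprod_ge0 rl w : 0 <= blockprod Q rl w.
Proof.
elim: rl w => //= -[c l] r IH w; rewrite mulr_ge0 //.
by case: (procQ c).
Qed.

Lemma blockprod_cat c l r u v : size u = l ->
  blockprod Q ((c, l) :: r) (u ++ v) = Q c u * blockprod Q r v.
Proof. by move=> <-; rewrite /= take_size_cat // drop_size_cat. Qed.

Lemma blockprod_mass rl : wsum (sumn (unzip2 rl)) (blockprod Q rl) = 1.
Proof.
elim: rl => [|[c l] r IH]; first by rewrite wsum0.
rewrite [sumn _]/= wsum_cat.
under eq_wsum => u su do under eq_wsum => v sv do rewrite blockprod_cat //.
by under eq_wsum => u su do rewrite wsumMl IH mulr1; rewrite wsum_process_mass.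
Qed.

Lemma blockprod_lower (D O : Type) (V : I -> R) (loss : W -> D -> R)
    (o : W -> O) (w0 : W) :
  (forall c l t (d : seq O -> D), (t < l)%N ->
    V c <= wsum l (fun w => Q c w * loss (nth w0 w t) (d (map o w)))) ->
  forall rl t (d : seq O -> D), (t < sumn (unzip2 rl))%N ->
    V (nth c0 (unrle rl) t) <=
    wsum (sumn (unzip2 rl))
      (fun w => blockprod Q rl w * loss (nth w0 w t) (d (map o w))).
Proof.
move=> HV; elim=> [|[c l] r IH] t d //; rewrite [sumn _]/= => tl.
rewrite wsum_cat [unrle _]/= -/(unrle r) nth_cat size_nseq.
case: ltnP => [ltl|lel].
  rewrite nth_nseq ltl /wsum exchange_big /=.
  have -> : V c = wsum (sumn (unzip2 r)) (fun v => blockprod Q r v * V c).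
    by rewrite wsumMr blockprod_mass mul1r.
  apply: ler_sum => v _.
  apply: (le_trans (ler_wpM2l (blockprod_ge0 r v)
           (HV c l t (fun z => d (z ++ map o v)) ltl))).
  rewrite -wsumMl; apply: ler_sum => u _.
  rewrite take_size_cat ?size_tuple // drop_size_cat ?size_tuple //.
  by rewrite map_cat nth_cat size_tuple ltl mulrA [Q c u * _]mulrC.
have -> : V (nth c0 (unrle r) (t - l)) =
          wsum l (fun u => Q c u * V (nth c0 (unrle r) (t - l))).
  by rewrite wsumMr wsum_process_mass ?mul1r.
have tl' : (t - l < sumn (unzip2 r))%N by rewrite ltn_subLR.
apply: le_wsum => u su; have [_ Q0 _] := procQ c.
apply: (le_trans (ler_wpM2l (Q0 u) (IH _ (fun z => d (map o u ++ z)) tl'))).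
rewrite -wsumMl; apply: le_wsum => v sv.
by rewrite blockprod_cat // map_cat nth_cat su ltnNge lel /= mulrA.
Qed.

(** The window of radius [K] around such a position stays inside one run, hence sees a single
    stationary process. *)
Fixpoint inner_position (K : nat) (rl : seq (I * nat)) (t : nat) : bool :=
  if rl is (c, l) :: r then
    if (t < l)%N then (K <= t)%N && (t + K < l)%N
    else inner_position K r (t - l)
  else false.

Lemma inner_position_ge K rl t : inner_position K rl t -> (K <= t)%N.
Proof.
elim: rl t => //= -[c l] r IH t; case: ltnP => _; first by case/andP.
by move=> /IH /leq_trans; apply; apply: leq_subr.
Qed.

(** Each run loses at most [K] positions at either end, or all of its positions if it is no longer
    than [2K]. *)
Lemma count_inner_position K rl :
  (\sum_(0 <= t < sumn (unzip2 rl)) ~~ inner_position K rl t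
     <= K.*2 * size rl)%N.
Proof.
elim: rl => [|[c l] r IH]; first by rewrite big_geq.
rewrite [sumn _]/= (@big_cat_nat _ _ _ l) ?leq_addr //= mulnS leq_add //.
  have short p q : (\sum_(p <= t < q) ~~ inner_position K ((c, l) :: r) t
                     <= q - p)%N.
    rewrite -[leqRHS]muln1 -sum_nat_const_nat.
    by apply: leq_sum => i _; exact: leq_b1.
  case: (leqP l K.*2) => lK.
    by apply: leq_trans lK; have := short 0%N l; rewrite subn0.
  rewrite (@big_cat_nat _ _ _ K) //=; last by lia.
  rewrite (@big_cat_nat _ _ _ (l - K) K) /=; [|lia|lia].
  rewrite -addnn leq_add //; first by have := short 0%N K; rewrite subn0.
  rewrite big1_seq; last first.
    by move=> t; rewrite mem_index_iota /= => /andP[Kt tl]; case: ifP; lia.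
  by apply: leq_trans (short (l - K)%N l) _; lia.
rewrite -[X in index_iota X _]add0n big_addn addKn; apply: leq_trans IH.
by apply: leq_sum => t _; rewrite ltnNge leq_addl addnK.
Qed.

(** The other blocks integrate to 1, and inside the block of [t] the window has the stationary
    marginal law by [wsum_window]. *)
Lemma blockprod_window K rl t (G : seq W -> R) :
  inner_position K rl t ->
  wsum (sumn (unzip2 rl))
    (fun w => blockprod Q rl w * G (take K.*2.+1 (drop (t - K) w))) =
  wsum K.*2.+1 (fun w => Q (nth c0 (unrle rl) t) w * G w).
Proof.
elim: rl t => [|[c l] r IH] t //=.
rewrite wsum_cat nth_cat size_nseq -/(unrle r); case: ltnP => [ltl /andP[Kt tKl]|lel inn].
  rewrite nth_nseq ltl.
  have El : l = (t - K + (K.*2.+1 + (l - (t + K).+1)))%N by lia.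
  rewrite -(wsum_window (procQ c) (statQ c) (t - K) _ (l - (t + K).+1)) -El.
  apply: eq_wsum => u su.
  rewrite -[RHS]mulr1 -(blockprod_mass r) -wsumMl; apply: eq_wsum => v sv.
  rewrite -su take_size_cat // drop_size_cat //.
  rewrite drop_cat ifT; last by lia.
  (* If the window ends exactly with the block, [take_cat] falls into its second branch, which takes
     no symbol of [v]. *)
  rewrite take_cat size_drop su; case: ltnP => h; first by rewrite mulrAC.
  have -> : (K.*2.+1 - (l - (t - K)) = 0)%N by lia.
  by rewrite take0 cats0 [take _ (drop _ u)]take_oversize ?size_drop ?su // mulrAC.
have Kt := inner_position_ge inn.
rewrite -(IH _ inn) -[RHS]mul1r -(wsum_process_mass (procQ c) l) -wsumMr.
apply: eq_wsum => u su; rewrite -wsumMl; apply: eq_wsum => v sv.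
rewrite -{1 2}su take_size_cat // drop_size_cat // mulrA.
by rewrite drop_cat su ifF; [congr (_ * G (take _ (drop _ _))); lia|lia].
Qed.

End BlockProducts.

(** * Bayes loss of finite windows *)

Section WindowLoss.
Variables (R : realType) (X Z Xh : finType) (Lam : X -> Xh -> R).
Hypothesis Lam0 : forall x y, 0 <= Lam x y.
Variable w0 : X * Z.

Definition window_loss (Q : seq (X * Z) -> R) K (f : seq Z -> Xh) : R :=
  wsum K.*2.+1 (fun w => Q w * Lam (nth w0 w K).1 (f (unzip2 w))).

(** The infimum runs over the radius as well as the rule: this is the denoisability of the source
    with unbounded two-sided context, obtained without a limit in [K]. *)
Definition best_window_loss Q : R :=
  inf [set window_loss Q K f | K in setT & f in setT].

Variables (Q : seq (X * Z) -> R).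
Hypotheses (procQ : is_process Q) (statQ : stationary Q).

Lemma window_loss_ge0 K f : 0 <= window_loss Q K f.
Proof. by apply: wsum_ge0 => w; rewrite mulr_ge0 //; case: procQ. Qed.

Lemma best_window_loss_le K f : best_window_loss Q <= window_loss Q K f.
Proof.
apply: ge_inf; last by exists K => //; exists f.
by exists 0 => _ [K' _ [f' _ <-]]; apply: window_loss_ge0.
Qed.

Lemma best_window_loss_ge0 (y0 : Xh) : 0 <= best_window_loss Q.
Proof.
apply: lb_le_inf; last by move=> _ [K _ [f _ <-]]; apply: window_loss_ge0.
by exists (window_loss Q 0 (fun=> y0)), 0%N => //; exists (fun=> y0).
Qed.

Lemma best_window_loss_adherent (y0 : Xh) e : 0 < e ->
  exists K f, window_loss Q K f < best_window_loss Q + e.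
Proof.
move=> e0.
have hi : has_inf [set window_loss Q K f | K in setT & f in setT].
  split; last by exists 0 => _ [K' _ [f' _ <-]]; apply: window_loss_ge0.
  by exists (window_loss Q 0 (fun=> y0)), 0%N => //; exists (fun=> y0).
by have [_ [K _ [f _ <-]] lt] := inf_adherent e0 hi; exists K, f.
Qed.

(** A wider window can ignore its margins. This provides one common radius for finitely many
    processes. *)
Lemma window_loss_widen K K' f : (K <= K')%N ->
  window_loss Q K' (fun z => f (take K.*2.+1 (drop (K' - K) z))) =
  window_loss Q K f.
Proof.
move=> KK'; rewrite /window_loss.
rewrite -(wsum_window procQ statQ (K' - K) _ (K' - K)
          (fun w => Lam (nth w0 w K).1 (f (unzip2 w)))).
have -> : (K' - K + (K.*2.+1 + (K' - K)) = K'.*2.+1)%N by lia.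
apply: eq_wsum => w sw; rewrite /unzip2 map_take map_drop.
by rewrite nth_take ?nth_drop ?subnK //; lia.
Qed.

Lemma best_window_loss_block l t (d : seq Z -> Xh) : (t < l)%N ->
  best_window_loss Q <=
  wsum l (fun w => Q w * Lam (nth w0 w t).1 (d (unzip2 w))).
Proof.
(* The smallest radius for which the window centred at [t] contains the whole block; the rule
   applies [d] to the block part of the window. *)
move=> tl; set K := maxn t (l - t.+1).
apply: le_trans (best_window_loss_le K (fun z => d (take l (drop (K - t) z)))) _.
rewrite -(wsum_window procQ statQ (K - t) l (K - (l - t.+1))
          (fun w => Lam (nth w0 w t).1 (d (unzip2 w)))) /window_loss.
have -> : (K - t + (l + (K - (l - t.+1))) = K.*2.+1)%N by lia.
apply: le_wsum => w sw; rewrite /unzip2 map_take map_drop.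
by rewrite nth_take ?nth_drop ?subnK //; lia.
Qed.

End WindowLoss.

(** * Expected maximum of the estimation error over one residue class *)

Section SwitchPenalty.
Variables (R : realType) (S C : finType) (T : Type) (key : T -> C) (theta : R).

(** Prepending a starting rule [st c] for each key means that every position, even the first with
    its key, is compared with a current state, so the weight factors position by position. *)
Definition switch_penalty (st : C -> S) (ts : seq T) (tau : seq S) : R :=
  \prod_c theta ^+ nswitch (st c :: [seq q.2 | q <- zip ts tau & key q.1 == c]).

Lemma switch_penalty_ge0 st ts tau : 0 <= theta -> 0 <= switch_penalty st ts tau.
Proof. by move=> th0; apply: prodr_ge0 => c _; rewrite exprn_ge0. Qed.

Lemma switch_penalty_cons st t ts s tau :
  switch_penalty st (t :: ts) (s :: tau) =
  theta ^+ (st (key t) != s) *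
  switch_penalty (fun c => if c == key t then s else st c) ts tau.
Proof.
rewrite /switch_penalty (bigD1 (key t)) //= eqxx nswitch_cons2 exprD -mulrA.
congr (_ * _); rewrite [RHS](bigD1 (key t)) //= eqxx; congr (_ * _).
apply: eq_bigr => c ct.
by rewrite eq_sym (negbTE ct).
Qed.

(** Whatever the current state, each position contributes weight 1 for keeping the rule and [theta]
    for each of the other rules. *)
Lemma sum_switch_penalty st ts :
  wsum (size ts) (switch_penalty st ts) =
  (1 + #|S|.-1%:R * theta) ^+ size ts.
Proof.
elim: ts st => [|t ts IH] st /=.
  by rewrite wsum0 /switch_penalty big1.
rewrite wsumS.
under eq_bigr => s _ do (under eq_wsum => tau _ do rewrite switch_penalty_cons;
  rewrite wsumMl IH).
rewrite -mulr_suml exprS; congr (_ * _).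
rewrite (bigD1 (st (key t))) //= eqxx expr0; congr (1 + _).
rewrite (eq_bigr (fun=> theta)) => [|s]; last by rewrite eq_sym => ->.
by rewrite sumr_const cardC1 mulr_natl.
Qed.

End SwitchPenalty.

Section ProductMeasure.
Variables (R : realType) (n : nat) (Z : finType) (p : 'I_n -> Z -> R).
Hypotheses (p0 : forall t z, 0 <= p t z) (p1 : forall t, \sum_z p t z = 1).

Definition prodmeas (z : n.-tuple Z) : R := \prod_(t < n) p t (tnth z t).

Lemma prodmeas_ge0 z : 0 <= prodmeas z.
Proof. exact: prodr_ge0. Qed.

Lemma sum_tuple_prod (g : 'I_n -> Z -> R) :
  \sum_(z : n.-tuple Z) \prod_(t < n) g t (tnth z t) = \prod_(t < n) \sum_z g t z.
Proof.
rewrite bigA_distr_bigA /= (reindex (fun f : {ffun 'I_n -> Z} => [tuple f i | i < n])) /=.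
  by apply: eq_bigr => f _; apply: eq_bigr => t _; rewrite tnth_mktuple.
exists (fun z : n.-tuple Z => [ffun i => tnth z i]).
- by move=> f _; apply/ffunP => i; rewrite ffunE tnth_mktuple.
- by move=> z _; apply: eq_from_tnth => i; rewrite tnth_mktuple ffunE.
Qed.

Lemma prodmeas_mass : \sum_z prodmeas z = 1.
Proof. by rewrite sum_tuple_prod big1. Qed.

Definition mix (I : pred 'I_n) (y z : n.-tuple Z) : n.-tuple Z :=
  [tuple if I t then tnth z t else tnth y t | t < n].

(* Conditioning on the coordinates outside [I], phrased as resampling: the
   measure-preserving involution [(y, z) |-> (mix I y z, mix I z y)] shows that
   [mix I y z] has the law of [y]. *)
Lemma resampling I (F : n.-tuple Z -> R) :
  \sum_z prodmeas z * F z =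
  \sum_y prodmeas y * \sum_z prodmeas z * F (mix I y z).
Proof.
transitivity (\sum_(q : n.-tuple Z * n.-tuple Z)
                prodmeas q.1 * prodmeas q.2 * F q.1).
  rewrite -(pair_big xpredT xpredT (fun y z => prodmeas y * prodmeas z * F y)) /=.
  apply: eq_bigr => y _; rewrite -[LHS]mulr1 -prodmeas_mass mulr_sumr.
  by apply: eq_bigr => z _; rewrite mulrAC.
rewrite (reindex (fun q => (mix I q.1 q.2, mix I q.2 q.1))) /=; last first.
  exists (fun q => (mix I q.1 q.2, mix I q.2 q.1)) => -[y z] _ /=;
    by congr pair; apply: eq_from_tnth => t; rewrite !tnth_mktuple; case: (I t).
rewrite -(pair_big xpredT xpredT (fun y z => prodmeas (mix I y z) *
            prodmeas (mix I z y) * F (mix I y z))) /=.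
apply: eq_bigr => y _; rewrite mulr_sumr; apply: eq_bigr => z _.
rewrite mulrA; congr (_ * _); rewrite /prodmeas -!big_split /=.
by apply: eq_bigr => t _; rewrite !tnth_mktuple; case: ifP => _ //; rewrite mulrC.
Qed.

(** From [expR (- y) >= 1 - y] comes the bound by [1 / (1 - y)], and [(1 + y + 2 y^2) (1 - y) = 1 +
    y^2 (1 - 2 y)] is at least 1. *)
Lemma expR_le_quadratic (y : R) : y <= 2^-1 -> expR y <= 1 + y + 2 * y ^+ 2.
Proof.
move=> y2; have h := expR_ge1Dx (- y).
have y1 : 0 < 1 - y by lra.
have : expR y <= (1 - y)^-1.
  by rewrite -[expR y]invrK lef_pV2 ?posrE ?invr_gt0 ?expR_gt0 // -expRN.
move/le_trans; apply.
rewrite -[leRHS](mulfK (lt0r_neq0 y1)) ler_pdivlMr // mulVf ?lt0r_neq0 //.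
nra.
Qed.

Section MaxInequality.
Variables (S C : finType) (Delta : 'I_n -> Z -> S -> R) (L lam : R).
Hypotheses (Delta_le : forall t z s, `|Delta t z s| <= L)
  (Delta_mean : forall t s, \sum_z p t z * Delta t z s = 0)
  (lam0 : 0 <= lam) (lamL : lam * L <= 2^-1).

(** In the quadratic majorant of the exponential the linear term has mean 0. *)
Lemma mgf_le t s :
  \sum_z p t z * expR (lam * Delta t z s) <= expR (2 * lam ^+ 2 * L ^+ 2).
Proof.
have key z : expR (lam * Delta t z s) <=
             1 + lam * Delta t z s + 2 * lam ^+ 2 * L ^+ 2.
  have := Delta_le t z s; rewrite ler_norml => /andP[D1 D2].
  apply: le_trans (expR_le_quadratic _) _.
    exact: le_trans (ler_wpM2l lam0 D2) lamL.
  rewrite lerD2l exprMn mulrA ler_wpM2l ?mulr_ge0 ?sqr_ge0 //.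
  by nra.
apply: (@le_trans _ _ (\sum_z p t z * (1 + lam * Delta t z s + 2 * lam ^+ 2 * L ^+ 2))).
  by apply: ler_sum => z _; rewrite ler_wpM2l.
under eq_bigr => z _ do rewrite -addrA [1 + _]addrC -addrA mulrDr mulrCA.
rewrite big_split /= -mulr_sumr Delta_mean mulr0 add0r -mulr_suml p1 mul1r.
by rewrite addrC expR_ge1Dx.
Qed.

(** For a fixed assignment the factors sit at distinct positions and are independent, so the
    exponential moments multiply. *)
Lemma mgf_assignment (s0 : S) (ts : seq 'I_n) (tau : seq S) :
  uniq ts -> size tau = size ts ->
  \sum_z prodmeas z * \prod_(q <- zip ts tau) expR (lam * Delta q.1 (tnth z q.1) q.2)
  <= expR (2 * lam ^+ 2 * L ^+ 2) ^+ size ts.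
Proof.
move=> uts sz; pose v t := nth s0 tau (index t ts).
have -> : tau = map v ts.
  apply: (@eq_from_nth _ s0) => [|i]; rewrite ?size_map // sz => its.
  have [t0 _] : exists t0 : 'I_n, True by case: ts its {uts v sz} => // t0; exists t0.
  by rewrite (nth_map t0) // /v index_uniq.
have -> : zip ts (map v ts) = [seq (t, v t) | t <- ts].
  by rewrite -[X in zip X _]map_id zip_map.
pose g t z := p t z * (if t \in ts then expR (lam * Delta t z (v t)) else 1).
rewrite (eq_bigr (fun z : n.-tuple Z => \prod_(t < n) g t (tnth z t))); last first.
  move=> z _; rewrite big_map /= big_split /=; congr (_ * _).
  by rewrite -big_mkcond big_uniq.
rewrite sum_tuple_prod -[size ts](card_uniqP uts) -prodr_const [leRHS]big_mkcond.
apply: ler_prod => t _; apply/andP; split.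
  by apply: sumr_ge0 => z _; rewrite mulr_ge0 //; case: ifP; rewrite ?expR_ge0.
rewrite /g; case: ifP => _; first exact: mgf_le.
by under eq_bigr => z _ do rewrite mulr1; rewrite p1.
Qed.

Variables (I : pred 'I_n) (key : n.-tuple Z -> 'I_n -> C)
  (sel : n.-tuple Z -> 'I_n -> S) (m : nat) (theta B : R) (s0 : S).
Hypotheses
  (key_mix : forall y z t, I t -> key (mix I y z) t = key y t)
  (sel_switch : forall z c,
     (nswitch [seq sel z t | t <- enum 'I_n & I t && (key z t == c)] <= m)%N)
  (theta0 : 0 <= theta) (theta1 : theta <= 1) (thetam : 0 < theta ^+ m)
  (countB : #|S|%:R ^+ #|C| * (1 + #|S|.-1%:R * theta) ^+ #|I|
            <= expR B * (theta ^+ m) ^+ #|C|).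

(** The selection depends on [z], but its keys on [I] are those of [y]; hence it is one of the
    assignments on the right. With at most [m] switches per key its weight is at least
    [(theta ^+ m) ^+ #|C|], and all other terms are nonnegative. *)
Lemma exp_selection_le y z ts : ts = [seq t <- enum 'I_n | I t] ->
  expR (lam * \sum_(t | I t) Delta t (tnth z t) (sel (mix I y z) t)) *
    (theta ^+ m) ^+ #|C| <=
  \sum_(st : {ffun C -> S}) wsum (size ts) (fun tau =>
    switch_penalty (key y) theta st ts tau *
    \prod_(q <- zip ts tau) expR (lam * Delta q.1 (tnth z q.1) q.2)).
Proof.
move=> tsE; pose x := mix I y z; pose tau := [seq sel x t | t <- ts].
have E : zip ts tau = [seq (t, sel x t) | t <- ts].
  by rewrite /tau -[X in zip X _]map_id zip_map.
(* The first rule selected for each key, so that the prepended comparison is no switch; [s0] serves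
   keys that do not occur. *)
pose st : {ffun C -> S} :=
  [ffun c => head s0 [seq q.2 | q <- zip ts tau & key y q.1 == c]].
have stau : size tau = size ts by rewrite size_map.
have nonneg (st' : C -> S) tau' : 0 <= switch_penalty (key y) theta st' ts tau' *
    \prod_(q <- zip ts tau') expR (lam * Delta q.1 (tnth z q.1) q.2).
  by rewrite mulr_ge0 ?switch_penalty_ge0 // prodr_ge0 // => q _; exact: expR_ge0.
rewrite (bigD1 st) //= -[leLHS]addr0; apply: lerD; last first.
  by apply: sumr_ge0 => st' _; apply: wsum_ge0.
rewrite -stau; apply: le_trans (ler_wsum_term tau (nonneg st)).
rewrite mulrC; apply: ler_pM => //.
- by rewrite exprn_ge0 // ltW.
- rewrite -prodr_const /switch_penalty; apply: ler_prod => c _.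
  rewrite exprn_ge0 //=; apply: ler_wiXn2l => //.
  have : (nswitch [seq q.2 | q <- zip ts tau & key y q.1 == c] <= m)%N.
    rewrite E filter_map -map_comp tsE -filter_predI.
    apply: leq_trans (sel_switch x c).
    rewrite (eq_filter (a2 := fun t => I t && (key x t == c))) // => t /=.
    by rewrite andbC; case It: (I t) => //=; rewrite key_mix.
  rewrite ffunE; case: [seq _ | _ <- _ & _] => [|s s1] //=.
  by rewrite nswitch_cons2 eqxx.
- by rewrite E big_map tsE big_filter big_enum_cond /= mulr_sumr expR_sum.
Qed.

(** After conditioning by [resampling], the exponential moment is at most [expR b]: there are
    [#|S| ^ #|C|] starting states, the weights sum geometrically, and each fixed assignment obeys
    [mgf_assignment]. Jensen's inequality then bounds the mean. *)
Lemma expected_selection_le :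
  lam * (\sum_z prodmeas z * \sum_(t | I t) Delta t (tnth z t) (sel z t)) <=
  B + 2 * lam ^+ 2 * L ^+ 2 * #|I|%:R.
Proof.
set b := leRHS; rewrite (resampling I) -[leRHS]mul1r -prodmeas_mass mulr_suml mulr_sumr.
apply: ler_sum => y _; rewrite mulrCA ler_wpM2l ?prodmeas_ge0 //.
pose G z := \sum_(t | I t) Delta t (tnth z t) (sel (mix I y z) t).
have -> : \sum_z prodmeas z *
    (\sum_(t | I t) Delta t (tnth (mix I y z) t) (sel (mix I y z) t)) =
    \sum_z prodmeas z * G z.
  apply: eq_bigr => z _; congr (_ * _); apply: eq_bigr => t It.
  by rewrite tnth_mktuple It.
have mgf : \sum_z prodmeas z * expR (lam * G z) <= expR b.
  set ts := [seq t <- enum 'I_n | I t].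
  have sts : size ts = #|I| by rewrite cardE /ts enumT.
  rewrite -(ler_pM2r (exprn_gt0 #|C| thetam)) mulr_suml.
  apply: (@le_trans _ _ (\sum_(st : {ffun C -> S}) wsum (size ts) (fun tau =>
    switch_penalty (key y) theta st ts tau *
      \sum_z prodmeas z *
        \prod_(q <- zip ts tau) expR (lam * Delta q.1 (tnth z q.1) q.2)))).
    under [leRHS]eq_bigr => st _ do under eq_wsum => tau _ do rewrite mulr_sumr.
    under [leRHS]eq_bigr => st _ do rewrite wsum_exchange.
    rewrite exchange_big /=; apply: ler_sum => z _; rewrite -mulrA.
    apply: le_trans (ler_wpM2l (prodmeas_ge0 z) (exp_selection_le y z erefl)) _.
    rewrite mulr_sumr; apply: ler_sum => st _; rewrite -wsumMl.
    by apply: le_wsum => tau _; rewrite mulrCA.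
  have uts : uniq ts by rewrite filter_uniq ?enum_uniq.
  apply: (@le_trans _ _ (\sum_(st : {ffun C -> S})
     (1 + #|S|.-1%:R * theta) ^+ #|I| * expR (2 * lam ^+ 2 * L ^+ 2) ^+ #|I|)).
    apply: ler_sum => st _; rewrite -sts -(sum_switch_penalty (key y) theta st).
    rewrite -wsumMr; apply: le_wsum => tau stau.
    by rewrite ler_wpM2l ?switch_penalty_ge0 // mgf_assignment.
  rewrite sumr_const card_ffun -[leLHS]mulr_natl natrX mulrA /b expRD [leRHS]mulrAC.
  by rewrite [2 * _ * _ * _]mulrC expRM_natl ler_wpM2r ?exprn_ge0 ?expR_ge0.
rewrite mulr_sumr.
(* Jensen's inequality through the tangent line: [u <= expR (u - b) - 1 + b]. *)
apply: (@le_trans _ _ (\sum_z prodmeas z * (expR (lam * G z) * expR (- b) - 1 + b))).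
  apply: ler_sum => z _; rewrite mulrCA ler_wpM2l ?prodmeas_ge0 //.
  by have := expR_ge1Dx (lam * G z - b); rewrite expRD; lra.
under eq_bigr => z _ do rewrite -addrA mulrDr mulrA.
rewrite big_split /= -!mulr_suml prodmeas_mass mul1r.
have : (\sum_z prodmeas z * expR (lam * G z)) * expR (- b) <= 1.
  by rewrite expRN ler_pdivrMr ?expR_gt0 // mul1r.
lra.
Qed.

End MaxInequality.

(** Resampling the coordinate [t] alone leaves the selected rule fixed, and a fixed rule has mean
    error 0. *)
Lemma expectation_independent (S : Type) (Delta : Z -> S -> R) t
    (sel : n.-tuple Z -> S) :
  (forall s, \sum_z p t z * Delta z s = 0) ->
  (forall y z, sel (mix (pred1 t) y z) = sel y) ->
  \sum_z prodmeas z * Delta (tnth z t) (sel z) = 0.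
Proof.
move=> mean indep; rewrite (resampling (pred1 t)) big1 // => y _.
under eq_bigr => z _ do rewrite indep tnth_mktuple /= eqxx.
pose g i z := p i z * (if i == t then Delta z (sel y) else 1).
rewrite (eq_bigr (fun z : n.-tuple Z => \prod_(i < n) g i (tnth z i))); last first.
  by move=> z _; rewrite big_split /= -big_mkcond big_pred1_eq.
rewrite sum_tuple_prod (bigD1 t) //= {1}/g eqxx mean mul0r mulr0 //.
Qed.

End ProductMeasure.

(** * The denoising setting *)

Lemma finite_bounded (R : realType) (T : finType) (F : T -> R) :
  exists2 L, 0 <= L & forall q, `|F q| <= L.
Proof.
exists (\sum_q `|F q|); first exact: sumr_ge0.
by move=> q; rewrite (bigD1 q) //= lerDl sumr_ge0.
Qed.

(* [theta] equates [N * theta] with the odds [p / (1 - p)], which makes the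
   geometric bound on the number of switching sequences match the entropy. *)
Lemma switch_count_entropy (R : realType) (N n m r C : nat) :
  let p : R := m%:R / n%:R in let theta := p / ((1 - p) * N%:R) in
  (0 < N)%N -> (0 < n)%N -> (m <= n./2)%N -> (r <= n)%N -> (0 < C)%N ->
  [/\ 0 <= theta, theta <= 1, 0 < theta ^+ m &
  N%:R ^+ C * (1 + N.-1%:R * theta) ^+ r <=
  expR (n%:R * (C%:R * (bin_entropy p + m.+1%:R * ln N%:R / n%:R))) *
    (theta ^+ m) ^+ C].
Proof.
move=> p theta N0 n0 mn rn C0.
have n0' : 0 < n%:R :> R by rewrite ltr0n.
have N1 : 1 <= N%:R :> R by rewrite ler1n.
have NS : N%:R = 1 + N.-1%:R :> R by rewrite -{1}(prednK N0) -natr1 addrC.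
have np : n%:R * p = m%:R by rewrite mulrC divfK ?gt_eqF.
have p0 : 0 <= p by rewrite divr_ge0.
have p2 : p <= 2^-1.
  have : m%:R * 2 <= n%:R :> R by rewrite -natrM ler_nat; lia.
  by rewrite /p ler_pdivrMr //; lra.
have q0 : 0 < 1 - p by lra.
have th : (1 - p) * N%:R * theta = p.
  by rewrite /theta mulrC divfK // mulf_neq0 ?gt_eqF //; lra.
have qN0 : 0 < (1 - p) * N%:R by rewrite mulr_gt0 //; lra.
have th0 : 0 <= theta by rewrite divr_ge0 // ltW.
have th1 : theta <= 1 by rewrite ler_pdivrMr // mul1r; nra.
have thm : 0 < theta ^+ m.
  case: (posnP m) => [->|m0]; first by rewrite expr0.
  by rewrite exprn_gt0 // divr_gt0 // divr_gt0 // ltr0n.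
have b0 : 0 <= 1 + N.-1%:R * theta by exact: addr_ge0 ler01 (mulr_ge0 (ler0n _ _) th0).
split=> //; clearbody theta.
have base : N%:R * (1 + N.-1%:R * theta) ^+ n <=
  expR (n%:R * (bin_entropy p + m.+1%:R * ln N%:R / n%:R)) * theta ^+ m.
  have -> : n%:R * (bin_entropy p + m.+1%:R * ln N%:R / n%:R) =
     n%:R * - ln (1 - p) + m%:R * (ln (1 - p) - ln p) + m.+1%:R * ln N%:R.
    rewrite -np /bin_entropy; field; by rewrite gt_eqF.
  rewrite !expRD !expRM_natl lnK ?posrE ?(lt_le_trans ltr01) //.
  rewrite expRN lnK ?posrE // exprS.
  (* By the choice of [theta] the product is a power of 1. The case [m = 0] is separate because then
     [p = 0]. *)
  have e1 : 1 <= expR (ln (1 - p) - ln p) ^+ m * (N%:R ^+ m * theta ^+ m).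
    case: (posnP m) => [->|m0]; first by rewrite !expr0 !mulr1.
    have p0' : 0 < p by rewrite divr_gt0 // ltr0n.
    rewrite expRD expRN !lnK ?posrE // -!exprMn.
    suff -> : (1 - p) / p * (N%:R * theta) = 1 by rewrite expr1n.
    by rewrite mulrAC mulrA th divff ?gt_eqF.
  (* Since [(1 - p) * N * theta = p], one has [(1 - p) * (1 + (N - 1) * theta) <= 1]. *)
  apply: le_trans (_ : N%:R * (1 - p)^-1 ^+ n <= _).
    rewrite ler_wpM2l // lerXn2r ?nnegrE ?invr_ge0 ?(ltW q0) ?b0 //.
    rewrite -[leRHS]mul1r ler_pdivlMr //.
    have e : (1 - p) * (N%:R * theta) = p by rewrite mulrA.
    have : (1 - p) * (N.-1%:R * theta) <= (1 - p) * (N%:R * theta).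
      by rewrite ler_wpM2l ?(ltW q0) // ler_wpM2r // NS lerDr.
    by rewrite e; lra.
  set u := (1 - p)^-1 ^+ n; set v := expR _ ^+ m in e1 *.
  have u0 : 0 <= N%:R * u by rewrite mulr_ge0 // exprn_ge0 // invr_ge0 ltW.
  have := ler_wpM2l u0 e1; rewrite mulr1 => /le_trans; apply.
  by rewrite le_eqVlt; apply/orP; left; apply/eqP; ring.
(* The base is at least 1, so the exponent [r] may be enlarged to [n * C]; the bound for one key is
   then raised to the power [C]. *)
apply: (@le_trans _ _ ((N%:R * (1 + N.-1%:R * theta) ^+ n) ^+ C)).
  rewrite exprMn ler_wpM2l ?exprn_ge0 // -exprM.
  have b1 : 1 <= 1 + N.-1%:R * theta by rewrite lerDl mulr_ge0.
  by rewrite ler_weXn2l //; apply: leq_trans rn _; rewrite leq_pmulr.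
rewrite mulrCA expRM_natl -exprMn.
by rewrite lerXn2r ?nnegrE ?mulr_ge0 ?exprn_ge0 ?expR_ge0.
Qed.

Lemma count_in_range n k : (2 * k <= n)%N ->
  (\sum_(t < n) @in_range n k t = n - 2 * k)%N.
Proof.
move=> kn; rewrite /in_range -(big_mkord xpredT (fun t => ((k <= t) && (t < n - k))%N : nat)).
rewrite (@big_cat_nat _ _ _ k) //=; last by lia.
rewrite (@big_cat_nat _ _ _ (n - k) k) /=; [|lia|lia].
rewrite big1_seq ?add0n; last by move=> t; rewrite mem_index_iota /=; lia.
rewrite [X in (_ + X)%N]big1_seq ?addn0; last first.
  by move=> t; rewrite mem_index_iota /=; lia.
rewrite (eq_big_nat _ _ (F2 := fun=> 1%N)); last by move=> t h; rewrite h.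
by rewrite sum_nat_const_nat; lia.
Qed.

Section Contexts.
Variables (Z : finType) (n k : nat).

Lemma size_ctx (z : n.-tuple Z) (t : 'I_n) : in_range k t ->
  size (ctx k z t).1 = k /\ size (ctx k z t).2 = k.
Proof.
by move=> /andP[kt tn]; rewrite /ctx /= !size_take_min !size_drop size_tuple; split; lia.
Qed.

Lemma eq_ctx (u v : n.-tuple Z) (t : 'I_n) : in_range k t ->
  (forall j : 'I_n, j != t -> (j <= t + k)%N -> (t <= j + k)%N ->
     tnth u j = tnth v j) ->
  ctx k u t = ctx k v t.
Proof.
move=> rt; have /andP[kt tn] := rt => uv.
have [su1 su2] := size_ctx u rt; have [sv1 sv2] := size_ctx v rt.
have E i (lt : (i < n)%N) : i != t -> (i <= t + k)%N -> (t <= i + k)%N ->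
    nth (tnth u t) u i = nth (tnth u t) v i.
  move=> h1 h2 h3; rewrite -[i]/(val (Ordinal lt)) -!tnth_nth; exact: uv.
rewrite [LHS]surjective_pairing [RHS]surjective_pairing; congr pair.
- apply: (@eq_from_nth _ (tnth u t)) => [|i]; rewrite su1 ?sv1 // => ik.
  by rewrite !nth_take // !nth_drop E //; lia.
- apply: (@eq_from_nth _ (tnth u t)) => [|i]; rewrite su2 ?sv2 // => ik.
  by rewrite !nth_take // !nth_drop E //; lia.
Qed.

(** Lets a rule that acts on a context and a centre symbol be evaluated as a window rule of radius
    [K]. *)
Lemma ctx_window K (z : n.-tuple Z) (t : 'I_n) : in_range k t -> (K <= k)%N ->
  drop (k - K) (ctx k z t).1 ++ tnth z t :: take K (ctx k z t).2 =
  take K.*2.+1 (drop (t - K) z).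
Proof.
move=> /andP[kt tn] Kk; rewrite /ctx /=.
have -> : K.*2.+1 = (K + K.+1)%N by lia.
rewrite takeD drop_drop.
have -> : (K + (t - K) = t)%N by lia.
have -> : drop t z = tnth z t :: drop t.+1 z.
  by rewrite (drop_nth (tnth z t)) ?size_tuple // -tnth_nth.
rewrite /= take_takel //.
congr (_ ++ _).
have -> : take k (drop (t - k) z) = take (K + (k - K)) (drop (t - k) z).
  by rewrite subnKC.
rewrite -take_drop drop_drop; congr (take _ (drop _ _)); lia.
Qed.

End Contexts.

(** * Joint law of channel input and output *)

Section JointProcess.
Variables (R : realType) (X Z : finType) (Pi : X -> Z -> R).
Hypothesis stochPi : stochastic Pi.

Definition joint (P : seq X -> R) (w : seq (X * Z)) : R :=
  P (unzip1 w) * \prod_(q <- w) Pi q.1 q.2.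

Lemma sum_joint_step (F : X -> R) c :
  \sum_(q : X * Z) F q.1 * (c * Pi q.1 q.2) = (\sum_x F x) * c.
Proof.
rewrite -(pair_big xpredT xpredT (fun x z => F x * (c * Pi x z))) /= mulr_suml.
apply: eq_bigr => x _; rewrite -mulr_sumr -mulr_sumr.
by case: stochPi => _ ->; rewrite mulr1.
Qed.

Lemma joint_process P : is_process P -> is_process (joint P).
Proof.
move=> [P1 P0 Pc]; split.
- by rewrite /joint P1 big_nil mulr1.
- move=> w; rewrite mulr_ge0 // prodr_ge0 // => q _; by case: stochPi.
- move=> w; rewrite [LHS]/joint Pc -sum_joint_step; apply: eq_bigr => q _.
  by rewrite /joint /unzip1 map_rcons big_rcons.
Qed.

Lemma joint_stationary P : stationary P -> stationary (joint P).
Proof.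
move=> Pc w; rewrite [LHS]/joint Pc -sum_joint_step; apply: eq_bigr => q _.
by rewrite /joint /= big_cons [Pi _ _ * _]mulrC.
Qed.

Lemma blockprod_joint (I : eqType) (P : I -> seq X -> R) rl w :
  size w = sumn (unzip2 rl) ->
  blockprod (fun c => joint (P c)) rl w =
  blockprod P rl (unzip1 w) * \prod_(q <- w) Pi q.1 q.2.
Proof.
elim: rl w => [|[c l] r IH] w /= sw.
  by rewrite (size0nil sw) big_nil mulr1.
rewrite IH ?size_drop ?sw ?addKn // /joint /unzip1 map_take map_drop.
by rewrite -[in RHS](cat_take_drop l w) map_cat big_cat /= mulrACA -map_cat cat_take_drop.
Qed.

Lemma sum_pair_tuples n (F : n.-tuple X -> n.-tuple Z -> R) :
  \sum_x \sum_z F x z =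
  \sum_(w : n.-tuple (X * Z)) F (map_tuple fst w) (map_tuple snd w).
Proof.
rewrite pair_big /= (reindex (fun w : n.-tuple (X * Z) =>
  (map_tuple fst w, map_tuple snd w))) //=.
exists (fun q => [tuple (tnth q.1 i, tnth q.2 i) | i < n]).
- move=> w _; apply: eq_from_tnth => i.
  by rewrite tnth_mktuple !tnth_map -surjective_pairing.
- move=> [x z] _ /=; congr pair; apply: eq_from_tnth => i;
  by rewrite tnth_map tnth_mktuple.
Qed.

Lemma sum_blockprod_joint (I : eqType) (P : I -> seq X -> R) n (a : n.-tuple I)
    (F : n.-tuple X -> n.-tuple Z -> R) (G : seq (X * Z) -> R) :
  (forall w : n.-tuple (X * Z), F (map_tuple fst w) (map_tuple snd w) = G w) ->
  \sum_(x : n.-tuple X) \sum_(z : n.-tuple Z)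
    blockprod P (rle a) x * prodmeas (fun t => Pi (tnth x t)) z * F x z =
  wsum (sumn (unzip2 (rle a)))
    (fun w => blockprod (fun c => joint (P c)) (rle a) w * G w).
Proof.
move=> FG; rewrite -size_unrle rleK size_tuple sum_pair_tuples.
apply: eq_bigr => w _; rewrite FG blockprod_joint; last first.
  by rewrite -size_unrle rleK !size_tuple.
congr (_ * _ * _); rewrite big_tuple.
by apply: eq_bigr => t _; rewrite !tnth_map.
Qed.

End JointProcess.

(** * The unbiased loss estimate and its expected error *)

Section Denoising.
Variables (R : realType) (X Z Xh : finType) (Pi : X -> Z -> R)
  (Lam : X -> Xh -> R) (H : Z -> X -> R).
Hypotheses (stochPi : stochastic Pi) (invH : chan_right_inv Pi H).

Local Notation chan x := (prodmeas (fun t => Pi (tnth x t))).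

Definition estimation_error x z (s : Smap Z Xh) : R :=
  Lam x (s z) - ell Pi H Lam z s.

(** As [H] is a right inverse of the channel, [ell] has channel mean [rho], which is also the mean
    of the true loss. *)
Lemma estimation_error_mean x s : \sum_z Pi x z * estimation_error x z s = 0.
Proof.
under eq_bigr => z _ do rewrite mulrBr.
rewrite sumrB; apply/eqP; rewrite subr_eq0; apply/eqP.
transitivity (rho Pi Lam s x); first by apply: eq_bigr => z _; rewrite mulrC.
rewrite /ell; under [RHS]eq_bigr => z _ do rewrite mulr_sumr.
rewrite exchange_big /=.
under eq_bigr => x' _ do (under eq_bigr => z _ do rewrite mulrA;
  rewrite -mulr_suml invH).
rewrite (bigD1 x) //= eqxx mul1r big1 ?addr0 // => x' /negbTE.
by rewrite eq_sym => ->; rewrite mul0r.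
Qed.

Lemma chan_ge0 n (x : n.-tuple X) z : 0 <= chan x z.
Proof. by apply: prodmeas_ge0 => t z'; case: stochPi. Qed.

Lemma chan_mass n (x : n.-tuple X) : \sum_z chan x z = 1.
Proof. by apply: prodmeas_mass => t; case: stochPi. Qed.

Lemma residue_eqF k i j : i != j -> (i <= j + k)%N -> (j <= i + k)%N ->
  (inord (i %% k.+1) == inord (j %% k.+1) :> 'I_k.+1) = false.
Proof.
move=> ij ijk jik; apply/negP => /eqP /(congr1 val).
rewrite /= !inordK ?ltn_pmod // => /eqP.
wlog lt : i j ij ijk jik / (i < j)%N => [hw|].
  by move: (ij); rewrite neq_ltn => /orP[/hw|/hw h /eqP/esym/eqP]; [apply|apply: h => //; rewrite eq_sym].
rewrite eq_sym eqn_mod_dvd ?(ltnW lt) // => /dvdn_leq.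
by rewrite subn_gt0 => /(_ lt); lia.
Qed.

(** Exponential rate, per position, of the bound on the number of rule sequences: for each of the
    [#|Z| ^ (2 k)] contexts, the entropy of the switch places plus [m + 1] choices of a rule. Twice
    this quantity is subtracted in the summability hypothesis. *)
Definition complexity (k m n : nat) : R :=
  #|Z|%:R ^+ (2 * k) * (bin_entropy (m%:R / (n - 2 * k)%:R) +
    m.+1%:R * ln #|{ffun Z -> Xh}|%:R / (n - 2 * k)%:R).

Lemma bin_entropy_ge0 (p : R) : 0 <= p -> p <= 1 -> 0 <= bin_entropy p.
Proof.
move=> p0 p1; rewrite /bin_entropy mulNr -opprD oppr_ge0 -oppr_ge0 opprD.
rewrite addr_ge0 // oppr_ge0 mulr_ge0_le0 ?ln_le0 //; lra.
Qed.

Lemma complexity_ge0 k m n : (0 < #|{ffun Z -> Xh}|)%N -> (m <= n - 2 * k)%N ->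
  0 <= complexity k m n.
Proof.
move=> N0 mn; rewrite mulr_ge0 ?exprn_ge0 // addr_ge0 //.
  rewrite bin_entropy_ge0 ?divr_ge0 //.
  case: (posnP (n - 2 * k)) => [->|n0]; first by rewrite invr0 mulr0.
  by rewrite ler_pdivrMr ?ltr0n // mul1r ler_nat.
by rewrite divr_ge0 // mulr_ge0 // ln_ge0 // ler1n.
Qed.

(* Positions in the same residue class mod [k + 1] do not occur in each other's
   contexts, so conditionally on the other classes the contexts are frozen. *)
Lemma expected_estimation_error n k m (x : n.-tuple X) (z0 : Z) (s0 : Smap Z Xh)
    (sel : n.-tuple Z -> 'I_n -> Smap Z Xh) (L lam : R) :
  (2 * k < n)%N -> (m <= (n - 2 * k)./2)%N ->
  (forall x z s, `|estimation_error x z s| <= L) ->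
  0 <= lam -> lam * L <= 2^-1 ->
  (forall z, in_Snkm k m z (sel z)) ->
  lam * (\sum_z chan x z *
    \sum_(t < n | in_range k t) estimation_error (tnth x t) (tnth z t) (sel z t)) <=
  k.+1%:R * ((n - 2 * k)%:R * complexity k m n) + 2 * lam ^+ 2 * L ^+ 2 * n%:R.
Proof.
move=> kn mn boundL lam0 lamL selS.
pose cls (t : 'I_n) : 'I_k.+1 := inord (t %% k.+1).
pose I (i : 'I_k.+1) : pred 'I_n := fun t => in_range k t && (cls t == i).
pose C := (k.-tuple Z * k.-tuple Z)%type.
pose key (z : n.-tuple Z) (t : 'I_n) : C :=
  (insubd (nseq_tuple k z0) (ctx k z t).1, insubd (nseq_tuple k z0) (ctx k z t).2).
have cardC : #|{: C}| = (#|Z| ^ (2 * k))%N.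
  by rewrite card_prod !card_tuple -expnD mul2n addnn.
have Z0 : (0 < #|Z|)%N by apply/card_gt0P; exists z0.
have Csum : (\sum_(i < k.+1) #|I i| = n - 2 * k)%N.
  rewrite -(count_in_range (ltnW kn)).
  transitivity (\sum_(t < n | in_range k t) 1)%N; last first.
    by rewrite big_mkcond; apply: eq_bigr => t _; case: in_range.
  rewrite (partition_big cls xpredT) //=.
  by apply: eq_bigr => i _; rewrite sum1_card.
have cardI i : (#|I i| <= n - 2 * k)%N by rewrite -Csum (bigD1 i) //= leq_addr.
have cls_le i : lam * (\sum_z chan x z *
    \sum_(t < n | I i t) estimation_error (tnth x t) (tnth z t) (sel z t)) <=
    (n - 2 * k)%:R * complexity k m n + 2 * lam ^+ 2 * L ^+ 2 * #|I i|%:R.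
  have [|||th0 th1 thm cnt] := @switch_count_entropy R #|{: Smap Z Xh}| (n - 2 * k) m
    #|I i| #|{: C}| _ _ mn (cardI i).
  - by apply/card_gt0P; exists s0.
  - by rewrite subn_gt0.
  - by rewrite cardC expn_gt0 Z0.
  apply: (@expected_selection_le _ _ _ (fun t => Pi (tnth x t)) _ _ _ _
     (fun t => estimation_error (tnth x t)) L lam _ _ _ _ (I i) key sel m _ _ s0
     _ _ th0 th1 thm); last by rewrite /complexity -(natrX _ #|Z|) -cardC; exact: cnt.
  - by move=> t z; case: stochPi.
  - by move=> t; case: stochPi.
  - by move=> t z s; apply: boundL.
  - by move=> t s; apply: estimation_error_mean.
  - by [].
  - by [].
  - move=> y z t /andP[rt /eqP ti]; rewrite /key.
    have -> // : ctx k (mix (I i) y z) t = ctx k y t.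
    apply: eq_ctx => // j jt h1 h2; rewrite tnth_mktuple /I -ti.
    by rewrite /cls residue_eqF ?andbF.
  (* Restriction to a residue class is passage to a subsequence, which cannot add switches. *)
  - move=> z c; apply: leq_trans (selS z (val c.1, val c.2)).
    apply: nswitch_subseq; apply: map_subseq.
    rewrite (eq_filter (a2 := predI (fun t => cls t == i)
      (fun t => in_range k t && (ctx k z t == (val c.1, val c.2))))).
      by rewrite filter_predI filter_subseq.
    move=> t /=; rewrite /I -andbA; case rt: (in_range k t) => //=.
      congr (_ && _); have [s1 s2] := size_ctx z rt.
      rewrite /key; case: c => c1 c2; rewrite !xpair_eqE /=.
      by congr (_ && _); rewrite -val_eqE val_insubd /= ?s1 ?s2 eqxx.
    by rewrite andbF.
have -> : lam * (\sum_z chan x z *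
    \sum_(t < n | in_range k t) estimation_error (tnth x t) (tnth z t) (sel z t)) =
  \sum_(i < k.+1) lam * (\sum_z chan x z *
    \sum_(t < n | I i t) estimation_error (tnth x t) (tnth z t) (sel z t)).
  rewrite -mulr_sumr exchange_big /=; congr (_ * _); apply: eq_bigr => z _.
  by rewrite -mulr_sumr (partition_big cls xpredT).
apply: le_trans (ler_sum _ (fun i _ => cls_le i)) _.
rewrite big_split /= sumr_const card_ord -[X in X + _ <= _]mulr_natl lerD2l -mulr_sumr.
apply: ler_wpM2l; first by rewrite mulr_ge0 ?sqr_ge0 // mulr_ge0 ?sqr_ge0.
by rewrite -natr_sum Csum ler_nat leq_subr.
Qed.

End Denoising.

(** * Regret bound for a fixed block length *)

Section Regret.
Variables (R : realType) (X Z Xh : finType) (Pi : X -> Z -> R)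
  (Lam : X -> Xh -> R) (H : Z -> X -> R).
Hypotheses (stochPi : stochastic Pi) (invH : chan_right_inv Pi H)
  (Lam0 : forall x y, 0 <= Lam x y).
Variables (I : finType) (P : I -> seq X -> R) (w0 : X * Z) (xh0 : Xh).
Hypotheses (procP : forall c, is_process (P c))
           (statP : forall c, stationary (P c)).

Local Notation chan x := (prodmeas (fun t => Pi (tnth x t))).
Local Notation Q := (fun c => joint Pi (P c)).
Let procQ c : is_process (Q c). Proof. exact: joint_process. Qed.
Let statQ c : stationary (Q c). Proof. exact: joint_stationary. Qed.

Definition block_expect n (a : n.-tuple I) (F : n.-tuple X -> n.-tuple Z -> R) : R :=
  \sum_(x : n.-tuple X) \sum_(z : n.-tuple Z)
    blockprod P (rle a) x * chan x z * F x z.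

Lemma block_expectE n (a : n.-tuple I) F :
  block_expect a F = \sum_(x : n.-tuple X) blockprod P (rle a) x * \sum_z chan x z * F x z.
Proof.
by apply: eq_bigr => x _; rewrite mulr_sumr; apply: eq_bigr => z _; rewrite mulrA.
Qed.

Lemma le_block_expect n (a : n.-tuple I) F G :
  (forall x, \sum_z chan x z * F x z <= \sum_z chan x z * G x z) ->
  block_expect a F <= block_expect a G.
Proof.
move=> FG; rewrite !block_expectE; apply: ler_sum => x _.
by rewrite ler_wpM2l // blockprod_ge0.
Qed.

Lemma block_expectD n (a : n.-tuple I) F G :
  block_expect a (fun x z => F x z + G x z) = block_expect a F + block_expect a G.
Proof.
rewrite -big_split; apply: eq_bigr => x _; rewrite -big_split.
by apply: eq_bigr => z _; rewrite mulrDr.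
Qed.

Lemma block_expect_sum n (a : n.-tuple I) (r : pred 'I_n)
    (F : 'I_n -> n.-tuple X -> n.-tuple Z -> R) :
  block_expect a (fun x z => \sum_(t | r t) F t x z) =
  \sum_(t | r t) block_expect a (F t).
Proof.
rewrite /block_expect [RHS]exchange_big; apply: eq_bigr => x _.
by rewrite [RHS]exchange_big; apply: eq_bigr => z _; rewrite mulr_sumr.
Qed.

Lemma block_expect_cst n (a : n.-tuple I) c : block_expect a (fun _ _ => c) = c.
Proof.
rewrite /block_expect (@sum_blockprod_joint _ _ _ _ _ P _ a _ (fun=> c)) //.
by rewrite wsumMr blockprod_mass ?mul1r.
Qed.

Lemma block_expect_le_cst n (a : n.-tuple I) F c :
  (forall x z, F x z <= c) -> block_expect a F <= c.
Proof.
move=> Fc; rewrite -[leRHS](block_expect_cst a); apply: le_block_expect => x.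
by apply: ler_sum => z _; rewrite ler_wpM2l ?chan_ge0.
Qed.

Local Notation V c := (best_window_loss Lam w0 (Q c)).

Lemma denoiser_lower n (a : n.-tuple I) (d : denoiser Z Xh n) :
  \sum_(t < n) V (tnth a t) <=
  block_expect a (fun x z => \sum_(t < n) Lam (tnth x t) (d t z)).
Proof.
rewrite block_expect_sum; apply: ler_sum => t _.
(* The denoiser extended to words of every length, with an arbitrary value off length [n]. *)
pose d' (z : seq Z) : Xh := oapp (d t) xh0 (insub z).
rewrite /block_expect (@sum_blockprod_joint _ _ _ _ _ P _ a _
  (fun w => Lam (nth w0 w t).1 (d' (unzip2 w)))); last first.
  move=> w; rewrite tnth_map -tnth_nth; congr Lam.
  by rewrite /d' -[unzip2 w]/(val (map_tuple snd w)) valK.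
have -> : tnth a t = nth (tnth a t) (unrle (rle a)) t by rewrite rleK -tnth_nth.
apply: (@blockprod_lower _ _ _ Q _ _ _ _ (fun c => V c)
   (fun (q : X * Z) y => Lam q.1 y) snd w0) => //.
  by move=> c l s d1 sl; apply: best_window_loss_block.
by rewrite -size_unrle rleK size_tuple.
Qed.

Variables (K k m n : nat) (f : I -> seq Z -> Xh) (e : R).
Hypotheses (Kk : (K <= k)%N) (kn : (2 * k < n)%N) (mn : (m <= (n - 2 * k)./2)%N)
  (f_opt : forall c, window_loss Lam w0 (Q c) K (f c) <= V c + e) (e0 : 0 <= e).

(** The observations enter only through the context of [t], never through [z_t]; both the switching
    constraint and the unbiasedness rest on this. *)
Definition genie (a : n.-tuple I) (z : n.-tuple Z) (t : 'I_n) : Smap Z Xh :=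
  [ffun z' => f (tnth a t)
     (drop (k - K) (ctx k z t).1 ++ z' :: take K (ctx k z t).2)].

(** Within one context the rule is a function of [a_t] alone, so its switches are bounded by those
    of a subsequence of [a]. *)
Lemma genie_in_Snkm (a : n.-tuple I) (z : n.-tuple Z) : (nswitch a <= m)%N -> in_Snkm k m z (genie a z).
Proof.
move=> am c.
pose g (i : I) : Smap Z Xh :=
  [ffun z' => f i (drop (k - K) c.1 ++ z' :: take K c.2)].
set ts := [seq t <- _ | _].
have -> : [seq genie a z t | t <- ts] = map g (map (tnth a) ts).
  rewrite -map_comp; apply/eq_in_map => t; rewrite mem_filter.
  by case/andP=> /andP[_ /eqP tc] _; rewrite /genie tc.
apply: leq_trans (nswitch_map _ _) _; apply: leq_trans am.
apply: nswitch_subseq; rewrite -[X in subseq _ X]map_tnth_enum.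
by apply: map_subseq; apply: filter_subseq.
Qed.

Lemma genie_mean (a : n.-tuple I) (x : n.-tuple X) t : in_range k t ->
  \sum_z chan x z *
    estimation_error Pi Lam H (tnth x t) (tnth z t) (genie a z t) = 0.
Proof.
move=> rt; apply: (@expectation_independent _ _ _ (fun t => Pi (tnth x t)) _ _ _ t
  (fun z => genie a z t)).
- by move=> s; case: stochPi.
- by move=> s; apply: estimation_error_mean.
- move=> y z; rewrite /genie (@eq_ctx _ _ _ _ y) // => j jt _ _.
  by rewrite tnth_mktuple /= (negbTE jt).
Qed.

Lemma genie_window_loss (a : n.-tuple I) t :
  in_range k t -> inner_position K (rle a) t ->
  block_expect a (fun x z => Lam (tnth x t) (genie a z t (tnth z t))) =
  window_loss Lam w0 (Q (tnth a t)) K (f (tnth a t)).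
Proof.
move=> rt inn; have Kt := inner_position_ge inn.
pose G (w : seq (X * Z)) := Lam (nth w0 w K).1 (f (tnth a t) (unzip2 w)).
rewrite /block_expect (@sum_blockprod_joint _ _ _ _ _ P _ a _
  (fun w => G (take K.*2.+1 (drop (t - K) w)))); last first.
  move=> w; rewrite /genie ffunE ctx_window // /G tnth_map; congr Lam.
    rewrite nth_take ?nth_drop; last by lia.
    by rewrite subnK // -tnth_nth.
  by rewrite /unzip2 map_take map_drop.
rewrite (@blockprod_window _ _ _ Q procQ statQ (tnth a t)) //.
by rewrite rleK -tnth_nth.
Qed.

Variables (Lx L lam : R) (sel : n.-tuple Z -> 'I_n -> Smap Z Xh).
Hypotheses (Lam_le : forall x y, Lam x y <= Lx)
  (err_le : forall x z s, `|estimation_error Pi Lam H x z s| <= L)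
  (lam0 : 0 < lam) (lamL : lam * L <= 2^-1)
  (sdude_sel : is_sdude_sel k m Pi H Lam sel).

(** The bound of [expected_estimation_error] divided by [lam], for losses summed over positions and
    not yet averaged. *)
Definition error_bound : R :=
  k.+1%:R * ((n - 2 * k)%:R * complexity R Z Xh k m n) / lam +
  2 * lam * L ^+ 2 * n%:R.

(** True loss is estimated loss plus estimation error. The estimated losses compare by minimality,
    the genie's error has mean 0, and each of the [2 k] border positions costs at most [Lx]. *)
Lemma sdude_vs_genie (a : n.-tuple I) (x : n.-tuple X) : (nswitch a <= m)%N ->
  \sum_z chan x z * (\sum_(t < n) Lam (tnth x t) (sdude k sel xh0 t z)) <=
  \sum_z chan x z * (error_bound + Lx * (2 * k)%:R +
    \sum_(t < n | in_range k t) Lam (tnth x t) (genie a z t (tnth z t))).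
Proof.
move=> am.
pose err z t s := estimation_error Pi Lam H (tnth x t) (tnth z t) s.
have n'0 : 0 < (n - 2 * k)%:R :> R by rewrite ltr0n subn_gt0.
have pointwise z : \sum_(t < n) Lam (tnth x t) (sdude k sel xh0 t z) <=
    \sum_(t < n | in_range k t) err z t (sel z t) -
    \sum_(t < n | in_range k t) err z t (genie a z t) +
    (Lx * (2 * k)%:R +
    \sum_(t < n | in_range k t) Lam (tnth x t) (genie a z t (tnth z t))).
  rewrite (bigID (fun t => in_range k t)) /=.
  have out : \sum_(t < n | ~~ in_range k t) Lam (tnth x t) (sdude k sel xh0 t z)
             <= Lx * (2 * k)%:R.
    apply: (@le_trans _ _ (\sum_(t < n | ~~ in_range k t) Lx)).
      by apply: ler_sum.
    rewrite sumr_const -[leLHS]mulr_natr.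
    suff -> : #|[pred t : 'I_n | ~~ in_range k t]| = (2 * k)%N by [].
    have := cardC [pred t : 'I_n | in_range k t]; rewrite card_ord.
    have -> : #|[pred t : 'I_n | in_range k t]| = (n - 2 * k)%N.
      rewrite -(count_in_range (ltnW kn)) -sum1_card big_mkcond /=.
      by apply: eq_bigr => t _; rewrite inE; case: in_range.
    have -> : #|[predC [pred t : 'I_n | in_range k t]]| =
              #|[pred t : 'I_n | ~~ in_range k t]| by apply: eq_card.
    by move: kn; lia.
  have [_ /(_ _ (genie_in_Snkm z am))] := sdude_sel z.
  rewrite /sdude_cost ler_pM2l ?invr_gt0 // => opt.
  have inn : \sum_(t < n | in_range k t) Lam (tnth x t) (sdude k sel xh0 t z) =
    \sum_(t < n | in_range k t) err z t (sel z t) +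
    \sum_(t < n | in_range k t) ell Pi H Lam (tnth z t) (sel z t).
    by rewrite -big_split; apply: eq_bigr => t rt; rewrite /sdude rt /err /estimation_error /= subrK.
  have gen : \sum_(t < n | in_range k t) Lam (tnth x t) (genie a z t (tnth z t)) =
    \sum_(t < n | in_range k t) err z t (genie a z t) +
    \sum_(t < n | in_range k t) ell Pi H Lam (tnth z t) (genie a z t).
    by rewrite -big_split; apply: eq_bigr => t rt; rewrite /err /estimation_error /= subrK.
  by rewrite inn gen; lra.
apply: (le_trans (ler_sum _ (fun z _ => ler_wpM2l (chan_ge0 stochPi x z) (pointwise z)))).
under eq_bigr => z _ do rewrite mulrDr mulrBr.
under [leRHS]eq_bigr => z _ do rewrite -addrA mulrDr.
rewrite !big_split /= sumrN lerD2r -mulr_suml chan_mass // mul1r.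
have -> : \sum_z chan x z * \sum_(t < n | in_range k t) err z t (genie a z t) = 0.
  under eq_bigr => z _ do rewrite mulr_sumr.
  by rewrite exchange_big big1 // => t rt; apply: genie_mean.
rewrite subr0 -(ler_pM2l lam0).
apply: (le_trans (expected_estimation_error stochPi invH x w0.2 [ffun=> xh0] kn mn err_le
  (ltW lam0) lamL (fun z => (sdude_sel z).1))).
rewrite /error_bound mulrDr le_eqVlt; apply/orP; left; apply/eqP.
by field; rewrite gt_eqF.
Qed.

Lemma sdude_upper (a : n.-tuple I) : (nswitch a <= m)%N ->
  block_expect a (fun x z => \sum_(t < n) Lam (tnth x t) (sdude k sel xh0 t z)) <=
  \sum_(t < n) V (tnth a t) +
  (error_bound + Lx * (2 * k)%:R + n%:R * e + Lx * (K.*2 * m.+1)%:R).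
Proof.
move=> am; apply: le_trans (le_block_expect _ (fun x => sdude_vs_genie x am)) _.
rewrite block_expectD block_expect_cst block_expect_sum.
rewrite -[X in _ <= _ + X]addrA [leRHS]addrCA lerD2l.
have Lx0 : 0 <= Lx by apply: le_trans (Lam0 w0.1 xh0) _.
have V0 c : 0 <= V c by apply: best_window_loss_ge0.
(* Inner positions cost at most [V + e], the others at most [Lx], and positions out of range are
   absent on the left. *)
apply: (@le_trans _ _ (\sum_(t < n)
   (V (tnth a t) + e + Lx * (~~ inner_position K (rle a) t)%:R))).
  rewrite big_mkcond; apply: ler_sum => t _; case: ifP => rt; last first.
    by rewrite addr_ge0 ?addr_ge0 // mulr_ge0.
  case inn: (inner_position K (rle a) t); last first.
    rewrite mulr1 -[leLHS]add0r lerD ?addr_ge0 //.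
    exact: block_expect_le_cst.
  by rewrite mulr0 addr0 genie_window_loss.
rewrite !big_split /= sumr_const card_ord mulr_natl [leRHS]addrA lerD2l -mulr_sumr.
rewrite ler_wpM2l // -natr_sum ler_nat.
rewrite -(big_mkord xpredT (fun t => ~~ inner_position K (rle a) t : nat)).
have {1}-> : n = sumn (unzip2 (rle a)) by rewrite -size_unrle rleK size_tuple.
apply: leq_trans (count_inner_position _ _) _.
by rewrite leq_mul2l (leq_trans (size_rle_le _)) ?ltnS ?orbT.
Qed.

Variables (pX : seq X -> R) (pA : seq I -> R).
Hypotheses (procA : is_process pA)
  (swA : forall a : n.-tuple I, 0 < pA a -> (nswitch a <= m)%N)
  (pXE : forall x : n.-tuple X,
     pX x = \sum_(a : n.-tuple I) pA a * blockprod P (rle a) x).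

Lemma exp_loss_mixture (d : denoiser Z Xh n) :
  exp_loss pX Pi Lam d = n%:R^-1 * \sum_(a : n.-tuple I) pA a *
    block_expect a (fun x z => \sum_(t < n) Lam (tnth x t) (d t z)).
Proof.
rewrite /exp_loss.
under [in RHS]eq_bigr => a _ do rewrite /block_expect mulr_sumr.
rewrite [in RHS]exchange_big mulr_sumr; apply: eq_bigr => x _.
under [in RHS]eq_bigr => a _ do rewrite mulr_sumr.
rewrite [in RHS]exchange_big mulr_sumr; apply: eq_bigr => z _ /=.
under [in RHS]eq_bigr => a _ do rewrite !mulrA.
by rewrite -!mulr_suml pXE /blockloss /prodmeas; ring.
Qed.

Lemma sdude_regret_le :
  exp_loss pX Pi Lam (sdude k sel xh0) - Dbayes n pX Pi Lam xh0 <=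
  k.+1%:R * complexity R Z Xh k m n / lam + 2 * lam * L ^+ 2 + e +
  Lx * (2 * k + K.*2 * m.+1)%:R / n%:R.
Proof.
have n0 : 0 < n%:R :> R by rewrite ltr0n (leq_ltn_trans _ kn).
set rest := (error_bound + Lx * (2 * k)%:R + n%:R * e + Lx * (K.*2 * m.+1)%:R).
pose low := n%:R^-1 * \sum_(a : n.-tuple I) pA a * \sum_(t < n) V (tnth a t).
have pA0 a : 0 <= pA a by case: procA.
have lower : low <= Dbayes n pX Pi Lam xh0.
  have lw (d : denoiser Z Xh n) : low <= exp_loss pX Pi Lam d.
    rewrite exp_loss_mixture ler_wpM2l ?invr_ge0 //; apply: ler_sum => a _.
    by rewrite ler_wpM2l // denoiser_lower.
  rewrite /Dbayes; elim/big_ind: _ => // u v lu lv.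
  by rewrite le_min lu lv.
have upper : exp_loss pX Pi Lam (sdude k sel xh0) <= low + n%:R^-1 * rest.
  rewrite exp_loss_mixture -mulrDr ler_wpM2l ?invr_ge0 //.
  have {1}-> : rest = \sum_(a : n.-tuple I) pA a * rest.
    by rewrite -mulr_suml; have := wsum_process_mass procA n; rewrite /wsum => ->; rewrite mul1r.
  rewrite -big_split; apply: ler_sum => a _; rewrite /= -mulrDr.
  (* The switch bound is available only for [a] of positive probability; the other terms vanish. *)
  have := pA0 a; rewrite le_eqVlt => /orP[/eqP <-|pa]; first by rewrite !mul0r.
  by rewrite ler_wpM2l // sdude_upper // swA.
have compl0 : 0 <= complexity R Z Xh k m n.
  apply: complexity_ge0; first by apply/card_gt0P; exists [ffun=> xh0].
  by move: mn; lia.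
have : n%:R^-1 * rest <= k.+1%:R * complexity R Z Xh k m n / lam + 2 * lam * L ^+ 2 + e +
  Lx * (2 * k + K.*2 * m.+1)%:R / n%:R.
  rewrite mulrC ler_pdivrMr // /rest /error_bound.
  have h : k.+1%:R * ((n - 2 * k)%:R * complexity R Z Xh k m n) / lam <=
      k.+1%:R * complexity R Z Xh k m n / lam * n%:R.
    rewrite [leRHS]mulrAC ler_pM2r ?invr_gt0 // -[leRHS]mulrA ler_wpM2l // [leLHS]mulrC ler_wpM2l //.
    by rewrite ler_nat leq_subr.
  have -> : (k.+1%:R * complexity R Z Xh k m n / lam + 2 * lam * L ^+ 2 + e +
    Lx * (2 * k + K.*2 * m.+1)%:R / n%:R) * n%:R =
    k.+1%:R * complexity R Z Xh k m n / lam * n%:R + 2 * lam * L ^+ 2 * n%:R + e * n%:R +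
    Lx * (2 * k + K.*2 * m.+1)%:R.
    by rewrite !mulrDl divfK ?gt_eqF.
  by rewrite natrD mulrDr; lra.
lra.
Qed.

End Regret.

(** * Passage to the limit *)

Lemma Lmax_ge0 (R : realType) (X Z Xh : finType) (Pi : X -> Z -> R)
  (H : Z -> X -> R) (Lam : X -> Xh -> R) : 0 <= Lmax Pi H Lam.
Proof. by rewrite addr_ge0 ?bigmax_ge_id. Qed.

(** The terms of a convergent series are eventually below 1. As the prefactor [2 (k + 1)] is at
    least 1, the exponential must be below 1, which places twice the complexity below
    [eps^2 / (2 (k + 1) Lmax^2)]. *)
Lemma complexity_vanishes (R : realType) (X Z Xh : finType)
  (Pi : X -> Z -> R) (Lam : X -> Xh -> R) (H : Z -> X -> R) (k m : nat -> nat) :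
  (0 < #|{ffun Z -> Xh}|)%N ->
  (forall n, (0 < n)%N -> (2 * k n < n)%N) ->
  (forall n, (m n <= (n - 2 * k n)./2)%N) ->
  (forall eps : R, 0 < eps ->
     cvg ((series (fun n : nat =>
       2 * (k n).+1%:R *
       expR (- ((n - 2 * k n)%:R *
          (eps ^+ 2 / (2 * (k n).+1%:R * Lmax Pi H Lam ^+ 2)
           - 2 * #|Z|%:R ^+ (2 * k n) *
             (bin_entropy ((m n)%:R / (n - 2 * k n)%:R)
              + (m n).+1%:R * ln #|{ffun Z -> Xh}|%:R / (n - 2 * k n)%:R)))) : R) : R ^nat)
       @ \oo)) ->
  forall delta : R, 0 < delta -> exists N0, forall n, (N0 <= n)%N ->
    (k n).+1%:R * complexity R Z Xh (k n) (m n) n < delta.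
Proof.
move=> N0 kn mn ser; set L := Lmax Pi H Lam.
have compl0 n : 0 <= complexity R Z Xh (k n) (m n) n.
  by apply: complexity_ge0 => //; have := mn n; lia.
have main (eps : R) : 0 < eps -> exists N1, forall n, (N1 <= n)%N ->
    2 * complexity R Z Xh (k n) (m n) n < eps ^+ 2 / (2 * (k n).+1%:R * L ^+ 2).
  move=> eps0; have := cvg_series_cvg_0 (ser eps eps0).
  move/cvgrPdist_lt => /(_ 1 ltr01) [N1 _ h].
  exists N1.+1 => n n1; have /= := h n (ltnW n1); rewrite sub0r normrN => h1.
  have n'0 : 0 < (n - 2 * k n)%:R :> R.
    by rewrite ltr0n subn_gt0 kn // (leq_ltn_trans _ n1).
  have k1 : 1 <= 2 * (k n).+1%:R :> R by rewrite -natrM ler1n.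
  have h2 := le_lt_trans (ler_norm _) h1.
  move: h2; rewrite -[2 * _ * (_ + _)]mulrA -/(complexity R Z Xh (k n) (m n) n) -/L.
  set D := _ / _ - _ => h2.
  rewrite -subr_gt0 -/D -(pmulr_rgt0 _ n'0) -oppr_lt0 ltNge; apply/negP => D0.
  have e1 : 1 <= expR (- ((n - 2 * k n)%:R * D)).
    by apply: le_trans (expR_ge1Dx _); rewrite lerDl.
  by have := ler_pM ler01 ler01 k1 e1; rewrite mulr1 leNgt h2.
(* If [L] were 0, the quotient in [main] would be 0 by the convention on division, making the
   complexity negative. *)
have L0 : 0 < L.
  rewrite lt_def Lmax_ge0 andbT; apply/eqP => L0.
  have [N1 /(_ N1 (leqnn _))] := main 1 ltr01.
  by rewrite L0 expr0n mulr0 invr0 mulr0 ltNge mulr_ge0.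
(* With this [eps] the bound of [main] reads [2 * delta / (k + 1)]. *)
move=> delta d0; have [|N1 h] := main (2 * L * Num.sqrt delta).
  by rewrite !mulr_gt0 ?sqrtr_gt0.
exists N1 => n /h; rewrite ltr_pdivlMr ?mulr_gt0 ?exprn_gt0 //.
rewrite !exprMn sqr_sqrtr ?ltW // => h1.
have L2 : 0 < 4 * L ^+ 2 by rewrite mulr_gt0 ?exprn_gt0.
by rewrite -(ltr_pM2l L2); lra.
Qed.

Lemma Dbayes_le (R : realType) (X Z Xh : finType) (Pi : X -> Z -> R)
    (Lam : X -> Xh -> R) (pX : seq X -> R) (xh0 : Xh) n (d : denoiser Z Xh n) :
  Dbayes n pX Pi Lam xh0 <= exp_loss pX Pi Lam d.
Proof.
pose d' : {ffun 'I_n -> {ffun n.-tuple Z -> Xh}} := [ffun t => [ffun z => d t z]].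
have -> : exp_loss pX Pi Lam d = exp_loss pX Pi Lam (fun t z => d' t z).
  apply: eq_bigr => x _; apply: eq_bigr => z _; congr (_ * (_ * _)).
  by apply: eq_bigr => t _; rewrite !ffunE.
exact: bigmin_le_cond.
Qed.

Lemma process_inhabited (R : realType) (T : finType) (p : seq T -> R) :
  is_process p -> exists x : T, True.
Proof.
move=> [p1 _ pc]; case: (pickP (@predT T)) => [x _|T0]; first by exists x.
by have := pc [::]; rewrite p1 big_pred0 // => /eqP; rewrite oner_eq0.
Qed.

(** The factor [(k + 1) (m + 1)] is isolated because, over [n - 2 k], it is controlled by
    [(k + 1) * complexity]. *)
Lemma exceptional_count_le k K m :
  (2 * k + K.*2 * m.+1 <= K.*2.+2 * (k.+1 * m.+1))%N.
Proof. by nia. Qed.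

Lemma half_le n : (n./2 <= n)%N.
Proof. by lia. Qed.

Theorem theorem6 (R : realType) (X Z Xh : finType)
  (Pi : X -> Z -> R) (Lam : X -> Xh -> R) (H : Z -> X -> R)
  (k m : nat -> nat) (xh0 : Xh)
  (sel : forall n, n.-tuple Z -> 'I_n -> Smap Z Xh)
  (pX : seq X -> R) :
  stochastic Pi -> full_row_rank Pi -> chan_right_inv Pi H ->
  (forall x xh, 0 <= Lam x xh) ->
  (forall n, (0 < n)%N -> (2 * k n < n)%N) ->
  (forall n, (m n <= (n - 2 * k n)./2)%N) ->
  (forall K, exists N0, forall n, (N0 <= n)%N -> (K <= k n)%N) ->
  (forall eps : R, 0 < eps ->
     cvg ((series (fun n : nat =>
       2 * (k n).+1%:R *
       expR (- ((n - 2 * k n)%:R *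
          (eps ^+ 2 / (2 * (k n).+1%:R * Lmax Pi H Lam ^+ 2)
           - 2 * #|Z|%:R ^+ (2 * k n) *
             (bin_entropy ((m n)%:R / (n - 2 * k n)%:R)
              + (m n).+1%:R * ln #|{ffun Z -> Xh}|%:R / (n - 2 * k n)%:R)))) : R) : R ^nat)
       @ \oo)) ->
  (forall n, is_sdude_sel (k n) (m n) Pi H Lam (sel n)) ->
  is_process pX -> in_class_P m pX ->
  (fun n => exp_loss pX Pi Lam (sdude (k n) (sel n) xh0) - Dbayes n pX Pi Lam xh0)
    @ \oo --> (0 : R).
Proof.
move=> stochPi _ invH Lam0 kn mn kinf ser sdude_sel procX.
move=> [M [P [pA [_ PP procA swA pXE]]]].
have [x0 _] := process_inhabited procX.
have [z0 _] : exists z0 : Z, True.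
  case: (pickP (@predT Z)) => [z _|Z0]; first by exists z.
  by have [_ /(_ x0)] := stochPi; rewrite big_pred0 // => /esym/eqP; rewrite oner_eq0.
have N0 : (0 < #|{ffun Z -> Xh}|)%N by apply/card_gt0P; exists [ffun=> xh0].
have procP c : is_process (P c) by case: (PP c).
have statP c : stationary (P c) by case: (PP c).
apply/cvgrPdist_lt => eps eps0.
have regret0 n : 0 <= exp_loss pX Pi Lam (sdude (k n) (sel n) xh0) -
    Dbayes n pX Pi Lam xh0 by rewrite subr_ge0 Dbayes_le.
(* With one reconstruction symbol [ln N = 0], and the [ln N] term no longer controls the exceptional
   positions; but then all denoisers coincide. *)
have [triv|[y1 y1xh0]] : (forall y : Xh, y = xh0) \/ exists y : Xh, y != xh0.
- case: (pickP (fun y : Xh => y != xh0)) => [y yx|no]; first by right; exists y.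
  by left=> y; apply/eqP; have := no y; case: eqP.
- have E n : exp_loss pX Pi Lam (sdude (k n) (sel n) xh0) - Dbayes n pX Pi Lam xh0 = 0.
    have E1 (d d' : denoiser Z Xh n) : exp_loss pX Pi Lam d = exp_loss pX Pi Lam d'.
      apply: eq_bigr => x _; apply: eq_bigr => z _; congr (_ * (_ * _)).
      by apply: eq_bigr => t _; rewrite [d t z]triv [d' t z]triv.
    apply/eqP; rewrite eq_le regret0 andbT subr_le0 /Dbayes.
    elim/big_ind: _ => [|u v hu hv|d _]; rewrite ?le_min ?hu ?hv //.
    + by rewrite (E1 _ (fun _ _ => xh0)).
    + by rewrite (E1 _ (fun t z => d t z)).
  by near=> n; rewrite E subr0 normr0.
have N2 : (1 < #|{ffun Z -> Xh}|)%N.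
  apply/card_gt1P; exists [ffun=> xh0], [ffun=> y1]; split=> //.
  by apply/eqP => /ffunP /(_ z0); rewrite !ffunE => /esym/eqP; apply/negP.
pose w0 := (x0, z0); pose e := eps / 8.
have e0 : 0 < e by rewrite divr_gt0.
pose V c := best_window_loss Lam w0 (joint Pi (P c)).
have [K [f f_opt]] : exists K (f : 'I_M -> seq Z -> Xh), forall c,
    window_loss Lam w0 (joint Pi (P c)) K (f c) <= V c + e.
  have /choice[g gP] : forall c, exists Kf : nat * (seq Z -> Xh),
      window_loss Lam w0 (joint Pi (P c)) Kf.1 Kf.2 <= V c + e.
    move=> c; have [K [f lt]] := best_window_loss_adherent Lam0 w0
      (joint_process stochPi (procP c)) xh0 e0.
    by exists (K, f); apply: ltW.
  (* The near-optimal windows of the [M] processes are widened to the largest radius. *)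
  exists (\max_c (g c).1)%N,
    (fun c z => (g c).2 (take (g c).1.*2.+1 (drop (\max_c (g c).1 - (g c).1) z))).
  move=> c; rewrite window_loss_widen //.
  - exact: joint_process.
  - exact: joint_stationary.
  - exact: leq_bigmax.
have [L L0 err_le] := finite_bounded
  (fun q : X * Z * Smap Z Xh => estimation_error Pi Lam H q.1.1 q.1.2 q.2).
have [Lx Lx0 Lam_le] := finite_bounded (fun q : X * Xh => Lam q.1 q.2).
(* Both [L] and [L^2] are at most [(1 + L)^2], so the two bounds on [eta] give [lam * L <= 1/2] and
   [2 * lam * L^2 <= eps / 8], also when [L = 0]. *)
pose eta := Num.min 2^-1 (eps / 16); pose lam := eta / (1 + L) ^+ 2.
have eta0 : 0 < eta by rewrite lt_min invr_gt0 ltr0n divr_gt0.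
have [eta1 eta2] : eta <= 2^-1 /\ eta <= eps / 16.
  by split; rewrite ge_min lexx ?orbT.
have A0 : 0 < (1 + L) ^+ 2 by rewrite exprn_gt0 //; lra.
have lam0 : 0 < lam by rewrite divr_gt0.
have lamA : lam * (1 + L) ^+ 2 = eta by rewrite divfK ?gt_eqF.
have lamL : lam * L <= 2^-1.
  apply: le_trans eta1; rewrite -lamA ler_pM2l //; nra.
have lamL2 : 2 * lam * L ^+ 2 <= eps / 8.
  have : lam * L ^+ 2 <= eta by rewrite -lamA ler_pM2l //; nra.
  lra.
have lnN : 0 < ln #|{ffun Z -> Xh}|%:R :> R by rewrite ln_gt0 // ltr1n.
pose c := Lx * K.*2.+2%:R + 1.
have c0 : 0 < c by rewrite ltr_wpDl // mulr_ge0.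
(* The first bound handles the estimation error. The second handles the exceptional positions, since
   the complexity is at least [(m + 1) ln N / (n - 2 k)]; the 1 added in [c] keeps it positive when
   [Lx = 0]. *)
pose delta := Num.min (lam * (eps / 8)) (ln #|{ffun Z -> Xh}|%:R * (eps / 8) / c).
have d0 : 0 < delta.
  by rewrite lt_min (mulr_gt0 lam0 e0) (divr_gt0 (mulr_gt0 lnN e0) c0).
have [N1 small] := complexity_vanishes N0 kn mn ser d0.
have [N3 kK] := kinf K.
exists (N1 + N3).+1 => // n /= nN.
rewrite sub0r normrN ger0_norm //.
have n0 : (0 < n)%N by exact: leq_ltn_trans nN.
have Kkn : (K <= k n)%N by apply/kK/(leq_trans (leq_addl N1 N3))/ltnW.
have := small n (leq_trans (leq_addr N3 N1) (ltnW nN)).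
rewrite lt_min => /andP[sm1 sm2].
have /le_lt_trans := sdude_regret_le stochPi invH Lam0 xh0 procP statP Kkn (kn n n0) (mn n)
  f_opt (ltW e0) (fun x y => le_trans (ler_norm _) (Lam_le (x, y)))
  (fun x z s => err_le (x, z, s)) lam0 lamL (sdude_sel n) procA (swA n) (pXE n).
apply.
have t1 : (k n).+1%:R * complexity R Z Xh (k n) (m n) n / lam <= eps / 8.
  by rewrite ler_pdivrMr // [leRHS]mulrC ltW.
have n'0 : 0 < (n - 2 * k n)%:R :> R by rewrite ltr0n subn_gt0 kn.
have t2 : Lx * (2 * k n + K.*2 * (m n).+1)%:R / n%:R <= eps / 8.
  have cl : (m n).+1%:R * ln #|{ffun Z -> Xh}|%:R / (n - 2 * k n)%:R <=
            complexity R Z Xh (k n) (m n) n.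
    rewrite /complexity; set u := leLHS; set h := bin_entropy _.
    have h0 : 0 <= h.
      rewrite bin_entropy_ge0 ?divr_ge0 // ler_pdivrMr // mul1r ler_nat.
      exact: leq_trans (mn n) (half_le _).
    have u0 : 0 <= u by rewrite divr_ge0 // mulr_ge0 // ltW.
    have Z1 : 1 <= #|Z|%:R ^+ (2 * k n) :> R.
      by rewrite exprn_ege1 // ler1n; apply/card_gt0P; exists z0.
    rewrite -[leLHS]mul1r; apply: ler_pM ler01 u0 Z1 _.
    by rewrite lerDr.
  have cnt : (2 * k n + K.*2 * (m n).+1)%:R <= K.*2.+2%:R * ((k n).+1 * (m n).+1)%:R :> R.
    by rewrite -natrM ler_nat exceptional_count_le.
  have fin : ((k n).+1 * (m n).+1)%:R / (n - 2 * k n)%:R * c <= eps / 8.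
    rewrite -(ler_pM2l lnN) mulrA -ler_pdivlMr //; apply/ltW.
    apply: le_lt_trans sm2; rewrite natrM.
    apply: le_trans (ler_wpM2l _ cl); last by [].
    by rewrite le_eqVlt; apply/orP; left; apply/eqP; ring.
  apply: le_trans fin.
  apply: (@le_trans _ _ (((k n).+1 * (m n).+1)%:R / (n - 2 * k n)%:R * (Lx * K.*2.+2%:R))).
    rewrite [leRHS]mulrAC; apply: ler_pM; rewrite ?mulr_ge0 ?invr_ge0 //.
      by rewrite [leRHS]mulrCA ler_wpM2l // [leRHS]mulrC.
    by rewrite lef_pV2 ?posrE ?n'0 ?ltr0n // ler_nat leq_subr.
  by rewrite ler_wpM2l ?divr_ge0 // /c lerDl.
(* Four terms of at most [eps / 8] each. *)
rewrite /e; lra.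
Unshelve. all: by end_near.
Qed.
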